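(* For constants $\alpha,\beta,\gamma$ let $$T_1^{(\alpha)}=u_1^2\Big(\frac{u_2}{u_1^4}\Big)^{\alpha},\qquad T_2^{(\beta,\gamma)}=u_1^2\Big(\frac{u_2}{u_1^4}\Big)^{\beta}\Big(\frac{u_1u_3-4u_2^2}{u_1^7}\Big)^{\gamma}.$$ Assume that $\alpha(\alpha-1)\gamma(\gamma-1)\ne 0$. Then there are only three commuting pairs among $T_1^{(\alpha)}$ and $T_2^{(\beta,\gamma)}$, i.e. $\{T_1^{(\alpha)},T_2^{(\beta,\gamma)}\}_{D_x^{-1}}=0$ exactly for $(\alpha,\beta,\gamma)=(\tfrac12,-\tfrac52,2)$, $(-1,-5,2)$, $(2,0,2)$; namely $$\Big\{u_2^{1/2},\ \frac{(u_1u_3-4u_2^2)^2}{u_1^2u_2^{5/2}}\Big\}_{D_x^{-1}}=\Big\{\frac{u_1^6}{u_2},\ \frac{u_1^8(u_1u_3-4u_2^2)^2}{u_2^5}\Big\}_{D_x^{-1}}=\Big\{\frac{u_2^2}{u_1^6},\ \frac{(u_1u_3-4u_2^2)^2}{u_1^{12}}\Big\}_{D_x^{-1}}=0.$$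
   Context: $u$ is a scalar dependent variable, $u_k=\partial_x^ku$, $D_x=\sum_{k\ge0}u_{k+1}\,\partial/\partial u_k$. Expressions are considered on an open domain where denominators do not vanish and smooth branches of the powers are fixed. A functional $\int g$ is the class of a differential function $g$ modulo $\operatorname{Im}D_x$; it is zero iff $g\in\operatorname{Im}D_x$. The variational derivative is $\delta_u g=\sum_{k\ge0}(-D_x)^k\,\partial g/\partial u_k$. The bracket with respect to $D_x^{-1}$ is $$\{f,g\}_{D_x^{-1}}=\int (\delta_u f)\,D_x^{-1}(\delta_u g),$$ where, for $g$ not depending on $u_0=u$, $D_x^{-1}\delta_u g=-\sum_{k\ge1}(-D_x)^{k-1}\,\partial g/\partial u_k$. Two densities commute if their bracket is the zero functional. *)

(* Defs.v *)
From Stdlib Require Import Reals List.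
From Coquelicot Require Import Coquelicot.
Open Scope R_scope.

(** Differential functions are complex valued, so that powers with arbitrary
    (complex) exponents and bases of either sign are covered; the jet variables
    [u 0], [u 1], [u 2], ... (that is, u, u_1, u_2, ...) are real. *)
Definition jet := nat -> R.

Definition upd (u : jet) (k : nat) (t : R) : jet :=
  fun j => if Nat.eqb j k then t else u j.

Definition agree (n : nat) (u v : jet) : Prop :=
  forall k, (k <= n)%nat -> u k = v k.

(** [open] refers to Coquelicot's uniform (sup) topology on [nat -> R]; for a set
    that constrains only [u 0, ..., u N] this is openness in R^(N+1). *)
Definition jet_domain (Om : jet -> Prop) : Prop :=
  (exists u, Om u) /\ open Om /\
  exists N, forall u v, agree N u v -> Om u -> Om v.

Definition partial (k : nat) (f : jet -> C) : jet -> C :=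
  fun u => (Derive (fun t => fst (f (upd u k t))) (u k),
            Derive (fun t => snd (f (upd u k t))) (u k)).

Definition partials (ks : list nat) (f : jet -> C) : jet -> C :=
  fold_right partial f ks.

Definition differentiable_in (k : nat) (f : jet -> C) (u : jet) : Prop :=
  ex_derive (fun t => fst (f (upd u k t))) (u k) /\
  ex_derive (fun t => snd (f (upd u k t))) (u k).

(** Smooth on [Om]: all iterated partial derivatives exist and are continuous. *)
Definition smooth_on (Om : jet -> Prop) (f : jet -> C) : Prop :=
  forall (ks : list nat) (u : jet), Om u ->
    continuous (partials ks f) u /\
    forall k, differentiable_in k (partials ks f) u.

Definition finite_order (Om : jet -> Prop) (f : jet -> C) : Prop :=
  exists n, forall u v, Om u -> Om v -> agree n u v -> f u = f v.

Definition differential_function (Om : jet -> Prop) (f : jet -> C) : Prop :=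
  finite_order Om f /\ smooth_on Om f.

(** The sums over all k below have only finitely many nonzero terms at points of
    the domain, because the functions involved have finite order there. *)
Definition Csum (a : nat -> C) : C :=
  (Series (fun k => fst (a k)), Series (fun k => snd (a k))).

Definition Dx (f : jet -> C) : jet -> C :=
  fun u => Csum (fun k => Cmult (RtoC (u (S k))) (partial k f u)).

Definition opp_Dx (f : jet -> C) : jet -> C := fun u => Copp (Dx f u).

Definition varder (g : jet -> C) : jet -> C :=
  fun u => Csum (fun k => Nat.iter k opp_Dx (partial k g) u).

(** D_x^{-1} (delta_u g) = - sum_{k >= 1} (-D_x)^{k-1} (dg/du_k), meaningful for
    [g] not depending on [u 0]; the summation index is shifted by one. *)
Definition Dx_inv_varder (g : jet -> C) : jet -> C :=
  fun u => Copp (Csum (fun k => Nat.iter k opp_Dx (partial (S k) g) u)).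

Definition zero_functional (Om : jet -> Prop) (g : jet -> C) : Prop :=
  exists h, differential_function Om h /\ forall u, Om u -> g u = Dx h u.

Definition bracket (f g : jet -> C) : jet -> C :=
  fun u => Cmult (varder f u) (Dx_inv_varder g u).

Definition commute (Om : jet -> Prop) (f g : jet -> C) : Prop :=
  zero_functional Om (bracket f g).

Definition Cexp (z : C) : C :=
  (exp (fst z) * cos (snd z), exp (fst z) * sin (snd z)).

(** [p] is a smooth branch on [Om] of the power [s ^ a]: [p = exp (a * L)] for a
    smooth branch [L] of [log s]. In particular [s] has no zero on [Om]. *)
Definition power_branch
    (Om : jet -> Prop) (s : jet -> R) (a : C) (p : jet -> C) : Prop :=
  exists L, differential_function Om L /\
    (forall u, Om u -> Cexp (L u) = RtoC (s u)) /\
    (forall u, Om u -> p u = Cexp (Cmult a (L u))).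

Definition w (u : jet) : R := u 1%nat * u 3%nat - 4 * u 2%nat ^ 2.

Definition base1 (u : jet) : R := u 2%nat / u 1%nat ^ 4.
Definition base2 (u : jet) : R := w u / u 1%nat ^ 7.

(** A density is a T_1^(alpha), resp. T_2^(beta, gamma), for some choice of the
    branches of the powers. *)
Definition is_T1 (Om : jet -> Prop) (alpha : C) (f : jet -> C) : Prop :=
  exists p, power_branch Om base1 alpha p /\
    forall u, Om u -> f u = Cmult (RtoC (u 1%nat ^ 2)) (p u).

Definition is_T2 (Om : jet -> Prop) (beta gamma : C) (g : jet -> C) : Prop :=
  exists p q, power_branch Om base1 beta p /\ power_branch Om base2 gamma q /\
    forall u, Om u ->
      g u = Cmult (Cmult (RtoC (u 1%nat ^ 2)) (p u)) (q u).

(* Main.v *)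
Require Import Defs.
From Stdlib Require Import Reals List.
From Stdlib Require Import Lra Lia QArith FunctionalExtensionality.
From Coquelicot Require Import Coquelicot.
(* Again, because [Rderiv.Dx] shadows [Defs.Dx]. *)
Require Import Defs.
Open Scope R_scope.
Set Bullet Behavior "Strict Subproofs".

(** A total derivative D_x h with h of order n is affine in u_(n+1), with slope
    dh/du_n. The bracket has order 5, so a primitive has order at most 4; after
    subtracting a primitive of its u_5-part, what remains has order 4 and must be
    affine in u_4. Its u_4^3-coefficient is a multiple of
    alpha (alpha - 1) gamma (gamma - 1) (gamma - 2), and for gamma = 2 its
    u_4^2-coefficient is a multiple of alpha (alpha - 1) (3 beta - 5 alpha + 10).
    When gamma = 2 and 3 beta = 5 alpha - 10 the bracket is, modulo an explicit total
    derivative, a function of u_1, u_2, u_3 proportional to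
    alpha (alpha - 1) (alpha + 1) (alpha - 2) (2 alpha - 1) w^5; being quintic in u_3,
    it is a total derivative only if this factor vanishes. *)

(** The powers are never computed. A branch of a power enters only through its logarithmic
    derivative, which is rational in the jet variables, so [f], [g] and [m] remain opaque symbols.
    Every claim about a bracket then becomes an identity between rational functions multiplied by
    these symbols, which [field] decides, and no choice of branch matters.

    The obstacle to necessity is that a primitive is an arbitrary smooth function of unknown finite
    order on a domain that may be disconnected. The order argument is therefore run in a box around
    one point. One point is enough, because each obstruction is a polynomial in the constants times
    a function that vanishes nowhere on the domain.

    Two systems of symbols are used. For general gamma the symbols include [g] and 1/w. For gamma =
    2 one has g = m w^2 with [m] free of u_3, so everything is polynomial in u_3 and the last
    obstruction can be read off by differentiating twice in u_3. *)

(** * Derivatives of complex-valued functions of a real variable *)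

Definition Cder (f : R -> C) (x : R) (l : C) : Prop :=
  is_derive (fun t => fst (f t)) x (fst l) /\
  is_derive (fun t => snd (f t)) x (snd l).

Lemma is_derive_eq (f : R -> R) (x l l' : R) :
  l = l' -> is_derive f x l -> is_derive f x l'.
Proof. now intros ->. Qed.

Lemma Cder_const (c : C) (x : R) : Cder (fun _ => c) x 0%C.
Proof. split; apply @is_derive_const. Qed.

Lemma Cder_RtoC (f : R -> R) (x l : R) :
  is_derive f x l -> Cder (fun t => RtoC (f t)) x (RtoC l).
Proof. intros H; split; [exact H | exact (is_derive_const 0 x)]. Qed.

Lemma Cder_plus (f g : R -> C) (x : R) (a b : C) :
  Cder f x a -> Cder g x b -> Cder (fun t => f t + g t)%C x (a + b)%C.
Proof. intros [H1 H2] [H3 H4]; split; apply @is_derive_plus; assumption. Qed.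

Lemma Cder_opp (f : R -> C) (x : R) (a : C) :
  Cder f x a -> Cder (fun t => - f t)%C x (- a)%C.
Proof. intros [H1 H2]; split; apply @is_derive_opp; assumption. Qed.

Lemma Cder_mult (f g : R -> C) (x : R) (a b : C) :
  Cder f x a -> Cder g x b ->
  Cder (fun t => f t * g t)%C x (a * g x + f x * b)%C.
Proof.
  intros [H1 H2] [H3 H4]; split; simpl.
  - eapply is_derive_eq;
      [| apply @is_derive_minus; apply Derive.is_derive_mult; eassumption].
    unfold minus, plus, opp; simpl; ring.
  - eapply is_derive_eq;
      [| apply @is_derive_plus; apply Derive.is_derive_mult; eassumption].
    unfold plus; simpl; ring.
Qed.

Lemma Cder_unique (f : R -> C) (x : R) (a b : C) :
  Cder f x a -> Cder f x b -> a = b.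
Proof.
  intros [H1 H2] [H3 H4]; apply injective_projections.
  - now rewrite <- (is_derive_unique _ _ _ H1), (is_derive_unique _ _ _ H3).
  - now rewrite <- (is_derive_unique _ _ _ H2), (is_derive_unique _ _ _ H4).
Qed.

Lemma Cder_ext_loc (f g : R -> C) (x : R) (a : C) :
  locally x (fun t => f t = g t) -> Cder f x a -> Cder g x a.
Proof.
  intros H [H1 H2]; split;
    [eapply is_derive_ext_loc; [| exact H1] | eapply is_derive_ext_loc; [| exact H2]];
    (eapply filter_imp; [| exact H]); intros t E; simpl; now rewrite E.
Qed.

Lemma Cder_eq (f : R -> C) (x : R) (a b : C) : a = b -> Cder f x a -> Cder f x b.
Proof. now intros ->. Qed.

Lemma Cder_Cexp (f : R -> C) (x : R) (a : C) :
  Cder f x a -> Cder (fun t => Cexp (f t)) x (Cexp (f x) * a)%C.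
Proof.
  intros [H1 H2]; split; simpl.
  - eapply is_derive_eq; [| apply Derive.is_derive_mult;
      [apply @is_derive_comp; [apply is_derive_exp | exact H1]
      |apply @is_derive_comp; [apply is_derive_cos | exact H2]]].
    unfold scal; simpl; unfold mult; simpl; ring.
  - eapply is_derive_eq; [| apply Derive.is_derive_mult;
      [apply @is_derive_comp; [apply is_derive_exp | exact H1]
      |apply @is_derive_comp; [apply is_derive_sin | exact H2]]].
    unfold scal; simpl; unfold mult; simpl; ring.
Qed.

(** * Jets *)

Lemma upd_same (u : jet) k : upd u k (u k) = u.
Proof.
  apply functional_extensionality; intros j; unfold upd.
  destruct (Nat.eqb_spec j k); congruence.
Qed.

Lemma upd_eq (u : jet) k t : upd u k t k = t.
Proof. unfold upd; now rewrite Nat.eqb_refl. Qed.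

Lemma upd_neq (u : jet) k t j : j <> k -> upd u k t j = u j.
Proof. intros H; unfold upd; now destruct (Nat.eqb_spec j k). Qed.

Lemma upd_upd (u : jet) k s t : upd (upd u k s) k t = upd u k t.
Proof.
  apply functional_extensionality; intros j; unfold upd.
  now destruct (Nat.eqb_spec j k).
Qed.

Lemma upd_comm (u : jet) k j s t :
  j <> k -> upd (upd u k s) j t = upd (upd u j t) k s.
Proof.
  intros H; apply functional_extensionality; intros i; unfold upd.
  destruct (Nat.eqb_spec i j), (Nat.eqb_spec i k); congruence.
Qed.

Lemma upd_locally (Om : jet -> Prop) u k :
  open Om -> Om u -> locally (u k) (fun t => Om (upd u k t)).
Proof.
  intros HO Hu; destruct (HO u Hu) as [eps He]; exists eps.
  intros t Ht; apply He; intros j; unfold upd.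
  destruct (Nat.eqb_spec j k) as [-> |]; [exact Ht | apply ball_center].
Qed.

Lemma partial_of_Cder f k u l :
  Cder (fun t => f (upd u k t)) (u k) l -> partial k f u = l.
Proof.
  intros [H1 H2]; unfold partial.
  apply injective_projections; simpl; apply is_derive_unique; assumption.
Qed.

Lemma Cder_partial f k u :
  differentiable_in k f u ->
  Cder (fun t => f (upd u k t)) (u k) (partial k f u).
Proof. intros [H1 H2]; split; apply Derive_correct; assumption. Qed.

Lemma differentiable_of_Cder f k u l :
  Cder (fun t => f (upd u k t)) (u k) l -> differentiable_in k f u.
Proof. intros [H1 H2]; split; eexists; eassumption. Qed.

(** Differentiation is local, so an equality on an open set survives it. This allows a density to be
    replaced by an expression that represents it on [Om] only. *)
Lemma partial_ext (Om : jet -> Prop) f g k u :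
  open Om -> (forall v, Om v -> f v = g v) -> Om u ->
  partial k f u = partial k g u.
Proof.
  intros HO E Hu; unfold partial; f_equal; apply Derive_ext_loc;
    (eapply filter_imp; [| apply (upd_locally Om u k HO Hu)]);
    intros t Ht; cbv beta in Ht |- *; now rewrite (E _ Ht).
Qed.

Lemma differentiable_ext (Om : jet -> Prop) f g k u :
  open Om -> (forall v, Om v -> f v = g v) -> Om u ->
  differentiable_in k f u -> differentiable_in k g u.
Proof.
  intros HO E Hu [H1 H2]; split;
    [eapply ex_derive_ext_loc; [| exact H1] | eapply ex_derive_ext_loc; [| exact H2]];
    (eapply filter_imp; [| apply (upd_locally Om u k HO Hu)]);
    intros t Ht; cbv beta in Ht |- *; now rewrite (E _ Ht).
Qed.

(** * Truncating the series to finite sums *)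

Fixpoint fsum (a : nat -> C) (n : nat) : C :=
  match n with O => a O | S m => (fsum a m + a (S m))%C end.

Lemma fsum_ext (a b : nat -> C) n :
  (forall k, (k <= n)%nat -> a k = b k) -> fsum a n = fsum b n.
Proof.
  induction n as [|n IH]; intros H; simpl; [apply H; lia |].
  rewrite IH, H by (intros; try apply H; lia); reflexivity.
Qed.

Lemma fsum_plus (a b : nat -> C) n : (fsum (fun k => a k + b k) n = fsum a n + fsum b n)%C.
Proof. induction n as [|n IH]; simpl; [reflexivity |]. rewrite IH; ring. Qed.

Lemma fsum_opp (a : nat -> C) n : (fsum (fun k => - a k) n = - fsum a n)%C.
Proof. induction n as [|n IH]; simpl; [reflexivity |]. rewrite IH; ring. Qed.

Lemma fsum_fst (a : nat -> C) n : fst (fsum a n) = sum_n (fun k => fst (a k)) n.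
Proof.
  induction n as [|n IH]; [now rewrite sum_O |].
  rewrite sum_Sn, <- IH; reflexivity.
Qed.

Lemma fsum_snd (a : nat -> C) n : snd (fsum a n) = sum_n (fun k => snd (a k)) n.
Proof.
  induction n as [|n IH]; [now rewrite sum_O |].
  rewrite sum_Sn, <- IH; reflexivity.
Qed.

Lemma Series_finite (a : nat -> R) n :
  (forall k, (n < k)%nat -> a k = 0) -> Series a = sum_n a n.
Proof.
  intros H; apply is_series_unique.
  apply filterlim_ext_loc with (f := fun _ => sum_n a n);
    [| apply filterlim_const].
  exists n; intros m Hm; induction Hm as [|m Hm IH]; [reflexivity |].
  rewrite sum_Sn, <- IH, H by lia; symmetry; apply @plus_zero_r.
Qed.

Lemma Csum_finite (a : nat -> C) n :
  (forall k, (n < k)%nat -> a k = 0%C) -> Csum a = fsum a n.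
Proof.
  intros H; unfold Csum; apply injective_projections; simpl.
  - rewrite fsum_fst; apply Series_finite; intros k Hk; now rewrite H.
  - rewrite fsum_snd; apply Series_finite; intros k Hk; now rewrite H.
Qed.

Lemma Csum_ext (a b : nat -> C) : (forall k, a k = b k) -> Csum a = Csum b.
Proof.
  intros H; unfold Csum; f_equal; apply Series_ext; intros k; now rewrite H.
Qed.

Lemma Dx_ext (Om : jet -> Prop) (f g : jet -> C) u :
  open Om -> (forall v, Om v -> f v = g v) -> Om u -> Dx f u = Dx g u.
Proof.
  intros HO E Hu; apply Csum_ext; intros k.
  now rewrite (partial_ext Om f g).
Qed.

(** * Formal differential expressions *)

Declare Scope expr_scope.
Delimit Scope expr_scope with E.

(** Rational numbers are kept apart from other constants because their numerals can be matched on,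
    which the simplifying constructors below rely on; [Cst] carries the parameters alpha, beta,
    gamma. [At] stands for a function known only through a table of its derivatives. *)
Inductive expr :=
  | Rat (q : Q)
  | Cst (c : C)
  | Var (k : nat)
  | At (i : nat)
  | Opp (e : expr)
  | Add (e1 e2 : expr)
  | Mul (e1 e2 : expr).
Bind Scope expr_scope with expr.

Fixpoint eval (at_ : nat -> jet -> C) (e : expr) (u : jet) : C :=
  match e with
  | Rat q => RtoC (IZR (Qnum q)) / RtoC (IZR (Zpos (Qden q)))
  | Cst c => c
  | Var k => RtoC (u k)
  | At i => at_ i u
  | Opp e => - eval at_ e u
  | Add e1 e2 => eval at_ e1 u + eval at_ e2 u
  | Mul e1 e2 => eval at_ e1 u * eval at_ e2 u
  end%C.

(* Simplifying 0 and 1 on the fly keeps iterated formal derivatives small. *)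
Definition sadd (e1 e2 : expr) : expr :=
  match e1, e2 with
  | Rat (0 # _), _ => e2
  | _, Rat (0 # _) => e1
  | _, _ => Add e1 e2
  end.

Definition smul (e1 e2 : expr) : expr :=
  match e1, e2 with
  | Rat (0 # _), _ => Rat 0
  | _, Rat (0 # _) => Rat 0
  | Rat (1 # 1), _ => e2
  | _, Rat (1 # 1) => e1
  | _, _ => Mul e1 e2
  end.

Definition sopp (e : expr) : expr :=
  match e with Rat (0 # _) => Rat 0 | _ => Opp e end.

Notation "e1 + e2" := (sadd e1 e2) : expr_scope.
Notation "e1 * e2" := (smul e1 e2) : expr_scope.
Notation "- e" := (sopp e) : expr_scope.
Notation "e1 - e2" := (sadd e1 (sopp e2)) : expr_scope.

Lemma Rat_0 at_ p u : eval at_ (Rat (0 # p)) u = 0%C.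
Proof. simpl; unfold Cdiv; ring. Qed.

Lemma Rat_1 at_ u : eval at_ (Rat 1) u = 1%C.
Proof. simpl; field. Qed.

Lemma eval_add at_ e1 e2 u :
  eval at_ (e1 + e2)%E u = (eval at_ e1 u + eval at_ e2 u)%C.
Proof.
  assert (L : forall p e, eval at_ e u = (eval at_ (Rat (0 # p)) u + eval at_ e u)%C)
    by (intros; rewrite Rat_0; ring).
  assert (R : forall p e, eval at_ e u = (eval at_ e u + eval at_ (Rat (0 # p)) u)%C)
    by (intros; rewrite Rat_0; ring).
  destruct e1 as [[[| |] ?]| | | | | |], e2 as [[[| |] ?]| | | | | |];
    first [apply L | apply R | reflexivity].
Qed.

Lemma eval_opp at_ e u : eval at_ (- e)%E u = (- eval at_ e u)%C.
Proof.
  destruct e as [[[| |] ?]| | | | | |]; try reflexivity.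
  simpl; unfold Cdiv; ring.
Qed.

Lemma eval_mul at_ e1 e2 u :
  eval at_ (e1 * e2)%E u = (eval at_ e1 u * eval at_ e2 u)%C.
Proof.
  assert (L : forall p e, eval at_ (Rat 0) u = (eval at_ (Rat (0 # p)) u * eval at_ e u)%C)
    by (intros; rewrite !Rat_0; ring).
  assert (R : forall p e, eval at_ (Rat 0) u = (eval at_ e u * eval at_ (Rat (0 # p)) u)%C)
    by (intros; rewrite !Rat_0; ring).
  assert (L1 : forall e, eval at_ e u = (eval at_ (Rat 1) u * eval at_ e u)%C)
    by (intros; rewrite Rat_1; ring).
  assert (R1 : forall e, eval at_ e u = (eval at_ e u * eval at_ (Rat 1) u)%C)
    by (intros; rewrite Rat_1; ring).
  destruct e1 as [[[|[| |]|] [| |]]| | | | | |], e2 as [[[|[| |]|] [| |]]| | | | | |];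
    first [apply L | apply R | apply L1 | apply R1 | reflexivity].
Qed.

(** [tab k i] represents the derivative of atom [i] with respect to u_k. Since it is itself an
    expression, expressions are closed under all partial derivatives. *)
Fixpoint d (tab : nat -> nat -> expr) (k : nat) (e : expr) : expr :=
  match e with
  | Rat _ | Cst _ => Rat 0
  | Var j => if Nat.eqb j k then Rat 1 else Rat 0
  | At i => tab k i
  | Opp e => - d tab k e
  | Add e1 e2 => d tab k e1 + d tab k e2
  | Mul e1 e2 => d tab k e1 * e2 + e1 * d tab k e2
  end%E.

(* Atoms are functions of u_0, ..., u_3. *)
Fixpoint ord (e : expr) : nat :=
  match e with
  | Rat _ | Cst _ => 0
  | Var j => j
  | At _ => 3
  | Opp e => ord e
  | Add e1 e2 | Mul e1 e2 => Nat.max (ord e1) (ord e2)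
  end.

Fixpoint ssum (a : nat -> expr) (n : nat) : expr :=
  match n with O => a O | S m => (ssum a m + a (S m))%E end.

Definition Dt tab (e : expr) : expr :=
  ssum (fun k => Var (S k) * d tab k e)%E (ord e).

Definition vd tab (e : expr) : expr :=
  ssum (fun k => Nat.iter k (fun e => - Dt tab e)%E (d tab k e)) (ord e).

Definition idv tab (e : expr) : expr :=
  (- ssum (fun k => Nat.iter k (fun e => - Dt tab e)%E (d tab (S k) e)) (ord e))%E.

(** Continuity and first derivatives are enough to demand: the table entries are expressions in the
    same atoms, so regularity of every order follows by iteration. *)
Record atoms (Om : jet -> Prop) (at_ : nat -> jet -> C)
    (tab : nat -> nat -> expr) : Prop := {
  atoms_finite_order : forall i, finite_order Om (at_ i);
  atoms_continuous : forall i u, Om u -> continuous (at_ i) u;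
  atoms_derive : forall i u k, Om u ->
    Cder (fun t => at_ i (upd u k t)) (u k) (eval at_ (tab k i) u);
  atoms_order : forall i u k, Om u -> (3 < k)%nat -> eval at_ (tab k i) u = 0%C
}.

Lemma eval_ssum at_ a n u : eval at_ (ssum a n) u = fsum (fun k => eval at_ (a k) u) n.
Proof. induction n as [|n IH]; simpl; [reflexivity |]. now rewrite eval_add, IH. Qed.

Lemma Cder_eval Om at_ tab e k u :
  atoms Om at_ tab -> Om u ->
  Cder (fun t => eval at_ e (upd u k t)) (u k) (eval at_ (d tab k e) u).
Proof.
  intros HA Hu; induction e as [q|c|j|i|e IH|e1 IH1 e2 IH2|e1 IH1 e2 IH2]; simpl.
  - refine (Cder_eq _ _ _ _ _ (Cder_const _ _)); unfold Cdiv; ring.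
  - refine (Cder_eq _ _ _ _ _ (Cder_const _ _)); unfold Cdiv; ring.
  - unfold upd; destruct (Nat.eqb_spec j k) as [-> |].
    + rewrite Rat_1; apply Cder_RtoC; apply @is_derive_id.
    + refine (Cder_eq _ _ _ _ _ (Cder_const _ _)); simpl; unfold Cdiv; ring.
  - now apply (atoms_derive Om).
  - rewrite eval_opp; now apply Cder_opp.
  - rewrite eval_add; now apply Cder_plus.
  - rewrite eval_add, !eval_mul.
    pose proof (Cder_mult _ _ _ _ _ IH1 IH2) as H; simpl in H.
    now rewrite upd_same in H.
Qed.

Lemma eval_d_ord Om at_ tab e k u :
  atoms Om at_ tab -> Om u -> (ord e < k)%nat -> eval at_ (d tab k e) u = 0%C.
Proof.
  intros HA Hu; induction e as [q|c|j|i|e IH|e1 IH1 e2 IH2|e1 IH1 e2 IH2];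
    intros Hk; cbn [ord d] in *.
  - apply Rat_0.
  - apply Rat_0.
  - destruct (Nat.eqb_spec j k); [lia | apply Rat_0].
  - now apply (atoms_order Om).
  - rewrite eval_opp, IH by lia; ring.
  - rewrite eval_add, IH1, IH2 by lia; ring.
  - rewrite eval_add, !eval_mul, IH1, IH2 by lia; ring.
Qed.

Lemma partial_eval Om at_ tab e k u :
  atoms Om at_ tab -> Om u -> partial k (eval at_ e) u = eval at_ (d tab k e) u.
Proof. intros HA Hu; apply partial_of_Cder; now apply (Cder_eval Om). Qed.

(** * Continuity and smoothness of evaluated expressions *)

Lemma continuous_Cplus (T : UniformSpace) (f g : T -> C) x :
  continuous f x -> continuous g x -> continuous (fun y => f y + g y)%C x.
Proof. apply (@continuous_plus T R_AbsRing C_R_NormedModule). Qed.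

Lemma continuous_pair (T : UniformSpace) (f g : T -> R) x :
  continuous f x -> continuous g x -> continuous (fun y => (f y, g y) : C) x.
Proof.
  intros Hf Hg; apply filterlim_locally; intros eps.
  pose proof (proj1 (filterlim_locally f (f x)) Hf eps) as H1.
  pose proof (proj1 (filterlim_locally g (g x)) Hg eps) as H2.
  eapply filter_imp; [| exact (filter_and _ _ H1 H2)].
  intros y [A B]; split; assumption.
Qed.

Lemma continuous_Cfst (T : UniformSpace) (f : T -> C) x :
  continuous f x -> continuous (fun y => fst (f y)) x.
Proof.
  intros Hf; apply filterlim_locally; intros eps.
  eapply filter_imp; [| exact (proj1 (filterlim_locally f (f x)) Hf eps)].
  intros y [A B]; exact A.
Qed.

Lemma continuous_Csnd (T : UniformSpace) (f : T -> C) x :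
  continuous f x -> continuous (fun y => snd (f y)) x.
Proof.
  intros Hf; apply filterlim_locally; intros eps.
  eapply filter_imp; [| exact (proj1 (filterlim_locally f (f x)) Hf eps)].
  intros y [A B]; exact B.
Qed.

Lemma continuous_Cmult (T : UniformSpace) (f g : T -> C) x :
  continuous f x -> continuous g x -> continuous (fun y => f y * g y)%C x.
Proof.
  intros Hf Hg.
  pose proof (continuous_Cfst T f x Hf) as F1.
  pose proof (continuous_Csnd T f x Hf) as F2.
  pose proof (continuous_Cfst T g x Hg) as G1.
  pose proof (continuous_Csnd T g x Hg) as G2.
  apply continuous_pair.
  - exact (@continuous_minus T R_AbsRing R_NormedModule _ _ x
      (@continuous_mult T R_AbsRing _ _ x F1 G1)
      (@continuous_mult T R_AbsRing _ _ x F2 G2)).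
  - exact (@continuous_plus T R_AbsRing R_NormedModule _ _ x
      (@continuous_mult T R_AbsRing _ _ x F1 G2)
      (@continuous_mult T R_AbsRing _ _ x F2 G1)).
Qed.

Lemma continuous_Cexp (T : UniformSpace) (f : T -> C) x :
  continuous f x -> continuous (fun y => Cexp (f y)) x.
Proof.
  intros Hf; apply continuous_pair; apply (@continuous_mult T R_AbsRing).
  - apply (continuous_comp (fun y => fst (f y)) exp);
      [now apply continuous_Cfst |].
    apply @ex_derive_continuous; eexists; apply is_derive_exp.
  - apply (continuous_comp (fun y => snd (f y)) cos);
      [now apply continuous_Csnd | apply continuous_cos].
  - apply (continuous_comp (fun y => fst (f y)) exp);
      [now apply continuous_Cfst |].
    apply @ex_derive_continuous; eexists; apply is_derive_exp.
  - apply (continuous_comp (fun y => snd (f y)) sin);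
      [now apply continuous_Csnd | apply continuous_sin].
Qed.

Lemma continuous_coord k (u : jet) : continuous (fun v : jet => v k) u.
Proof.
  apply filterlim_locally; intros eps; exists eps; intros v Hv; apply Hv.
Qed.

Lemma continuous_eval Om at_ tab e u :
  atoms Om at_ tab -> Om u -> continuous (eval at_ e) u.
Proof.
  intros HA Hu; induction e as [q|c|j|i|e IH|e1 IH1 e2 IH2|e1 IH1 e2 IH2]; simpl.
  - apply continuous_const.
  - apply continuous_const.
  - apply continuous_pair; [apply continuous_coord | apply continuous_const].
  - now apply (atoms_continuous Om _ tab).
  - now apply (@continuous_opp _ R_AbsRing C_R_NormedModule).
  - now apply continuous_Cplus.
  - now apply continuous_Cmult.
Qed.

Lemma eval_finite_order Om at_ tab e :
  atoms Om at_ tab -> finite_order Om (eval at_ e).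
Proof.
  intros HA; induction e as [q|c|j|i|e IH|e1 IH1 e2 IH2|e1 IH1 e2 IH2].
  - now exists O.
  - now exists O.
  - exists j; intros u v _ _ H; simpl; now rewrite H.
  - apply (atoms_finite_order Om at_ tab HA).
  - destruct IH as [n H]; exists n; intros u v Hu Hv E; simpl; now rewrite (H u v).
  - destruct IH1 as [n H], IH2 as [m H2]; exists (Nat.max n m).
    intros u v Hu Hv E; simpl; rewrite (H u v), (H2 u v); trivial;
      intros k Hk; apply E; lia.
  - destruct IH1 as [n H], IH2 as [m H2]; exists (Nat.max n m).
    intros u v Hu Hv E; simpl; rewrite (H u v), (H2 u v); trivial;
      intros k Hk; apply E; lia.
Qed.

Lemma partials_eval Om at_ tab e ks u :
  open Om -> atoms Om at_ tab -> Om u ->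
  partials ks (eval at_ e) u = eval at_ (fold_right (d tab) e ks) u.
Proof.
  intros HO HA; revert u; induction ks as [|k ks IH]; intros u Hu; simpl;
    [reflexivity |].
  rewrite <- (partial_eval Om) by assumption.
  now apply (partial_ext Om).
Qed.

Lemma eval_differential_function Om at_ tab e :
  open Om -> atoms Om at_ tab -> differential_function Om (eval at_ e).
Proof.
  intros HO HA; split; [now apply (eval_finite_order _ _ tab) |].
  intros ks u Hu; split.
  - eapply continuous_ext_loc;
      [| apply (continuous_eval Om at_ tab (fold_right (d tab) e ks) u HA Hu)].
    eapply filter_imp; [| apply (HO u Hu)]; intros v Hv; symmetry.
    now apply (partials_eval Om).
  - intros k.
    apply (differentiable_ext Om (eval at_ (fold_right (d tab) e ks)));
      trivial.
    + intros v Hv; symmetry; now apply (partials_eval Om).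
    + eapply differentiable_of_Cder; now apply (Cder_eval Om at_ tab).
Qed.

(** * Agreement of formal and actual total derivatives, variational derivatives and brackets *)

Lemma eval_D Om at_ tab e u :
  atoms Om at_ tab -> Om u -> Dx (eval at_ e) u = eval at_ (Dt tab e) u.
Proof.
  intros HA Hu; unfold Dx, Dt; rewrite eval_ssum.
  etransitivity; [apply (Csum_finite _ (ord e)) | apply fsum_ext].
  - intros k Hk; rewrite (partial_eval Om at_ tab) by assumption.
    rewrite (eval_d_ord Om) by assumption; ring.
  - intros k _; rewrite eval_mul; simpl.
    now rewrite (partial_eval Om at_ tab).
Qed.

Lemma iter_opp_Dx (Om : jet -> Prop) at_ tab (f : jet -> C) e n u :
  open Om -> atoms Om at_ tab -> (forall v, Om v -> f v = eval at_ e v) -> Om u ->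
  Nat.iter n opp_Dx f u = eval at_ (Nat.iter n (fun e => - Dt tab e)%E e) u.
Proof.
  intros HO HA E; revert u; induction n as [|n IH]; intros u Hu; simpl; [auto |].
  unfold opp_Dx at 1.
  rewrite (Dx_ext Om _ _ u HO IH Hu), (eval_D Om at_ tab) by assumption.
  now rewrite eval_opp.
Qed.

(** Cuts off the variational series: beyond the order, [d tab k e] is only known to evaluate to 0 on
    [Om], and the iterated total derivatives applied to it must preserve this. *)
Lemma iter_D_zero Om at_ tab e n u :
  open Om -> atoms Om at_ tab -> (forall v, Om v -> eval at_ e v = 0%C) -> Om u ->
  eval at_ (Nat.iter n (fun e => - Dt tab e)%E e) u = 0%C.
Proof.
  intros HO HA E; revert u; induction n as [|n IH]; intros u Hu; simpl; [auto |].
  rewrite eval_opp, <- (eval_D Om) by assumption.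
  rewrite (Dx_ext Om _ (eval at_ (Rat 0)) u) by (try assumption;
    intros; rewrite Rat_0; auto).
  rewrite (eval_D Om at_ tab) by assumption.
  unfold Dt; simpl; unfold Cdiv; ring.
Qed.

Lemma varder_eval (Om : jet -> Prop) at_ tab (f : jet -> C) e u :
  open Om -> atoms Om at_ tab -> (forall v, Om v -> f v = eval at_ e v) -> Om u ->
  varder f u = eval at_ (vd tab e) u.
Proof.
  intros HO HA E Hu; unfold varder, vd.
  assert (I : forall k, Nat.iter k opp_Dx (partial k f) u
      = eval at_ (Nat.iter k (fun e => - Dt tab e)%E (d tab k e)) u).
  { intros k; apply (iter_opp_Dx Om); trivial; intros v Hv.
    rewrite <- (partial_eval Om) by assumption; now apply (partial_ext Om). }
  rewrite (Csum_ext _ _ I), eval_ssum; apply Csum_finite; intros k Hk.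
  apply (iter_D_zero Om); trivial; intros v Hv; now apply (eval_d_ord Om).
Qed.

Lemma Dx_inv_varder_eval (Om : jet -> Prop) at_ tab (f : jet -> C) e u :
  open Om -> atoms Om at_ tab -> (forall v, Om v -> f v = eval at_ e v) -> Om u ->
  Dx_inv_varder f u = eval at_ (idv tab e) u.
Proof.
  intros HO HA E Hu; unfold Dx_inv_varder, idv.
  assert (I : forall k, Nat.iter k opp_Dx (partial (S k) f) u
      = eval at_ (Nat.iter k (fun e => - Dt tab e)%E (d tab (S k) e)) u).
  { intros k; apply (iter_opp_Dx Om); trivial; intros v Hv.
    rewrite <- (partial_eval Om) by assumption; now apply (partial_ext Om). }
  rewrite eval_opp; f_equal.
  rewrite (Csum_ext _ _ I), eval_ssum; apply Csum_finite; intros k Hk.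
  apply (iter_D_zero Om); trivial; intros v Hv; apply (eval_d_ord Om); auto.
Qed.

Lemma bracket_eval (Om : jet -> Prop) at_ tab (f g : jet -> C) ef eg u :
  open Om -> atoms Om at_ tab ->
  (forall v, Om v -> f v = eval at_ ef v) ->
  (forall v, Om v -> g v = eval at_ eg v) -> Om u ->
  bracket f g u = (eval at_ (vd tab ef) u * eval at_ (idv tab eg) u)%C.
Proof.
  intros; unfold bracket.
  now rewrite (varder_eval Om at_ tab f ef), (Dx_inv_varder_eval Om at_ tab g eg).
Qed.

Lemma commute_of_primitive (Om : jet -> Prop) at_ tab (f g : jet -> C) ef eg eh :
  open Om -> atoms Om at_ tab ->
  (forall v, Om v -> f v = eval at_ ef v) ->
  (forall v, Om v -> g v = eval at_ eg v) ->
  (forall v, Om v -> (eval at_ (vd tab ef) v * eval at_ (idv tab eg) v)%C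
                     = eval at_ (Dt tab eh) v) ->
  commute Om f g.
Proof.
  intros HO HA Ef Eg E; exists (eval at_ eh); split.
  - now apply (eval_differential_function Om at_ tab).
  - intros u Hu; rewrite (eval_D Om at_ tab) by assumption.
    rewrite <- E by assumption; now apply (bracket_eval Om).
Qed.

(** * Boxes and independence of a jet variable *)

(** Sections of a box along a coordinate are intervals. Hence a vanishing partial derivative gives
    independence throughout the box, whereas on a general open set it would do so only locally. *)
Definition box (c : jet) (r : posreal) (u : jet) : Prop :=
  forall k, Rabs (u k - c k) < r.

Lemma box_sub (Om : jet -> Prop) c :
  open Om -> Om c -> exists r, forall u, box c r u -> Om u.
Proof.
  intros HO Hc; destruct (HO c Hc) as [r Hr]; exists r.
  intros u Hu; apply Hr; intros k; apply (Hu k).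
Qed.

Lemma box_center c r : box c r c.
Proof.
  intros k; unfold Rminus; rewrite Rplus_opp_r, Rabs_R0; apply cond_pos.
Qed.

Lemma box_upd c r u k t :
  box c r u -> Rabs (t - c k) < r -> box c r (upd u k t).
Proof.
  intros Hu Ht j; unfold upd; destruct (Nat.eqb_spec j k) as [-> |]; auto.
Qed.

Lemma box_upd_inv c r u k t : box c r (upd u k t) -> Rabs (t - c k) < r.
Proof. intros H; specialize (H k); now rewrite upd_eq in H. Qed.

(** With infinitely many coordinates a box need not be open in the sup topology, since the distances
    to its faces may have infimum 0. Moving one coordinate is still possible, and the arguments
    below do nothing else. *)
Lemma box_locally c r u k :
  box c r u -> locally (u k) (fun t => box c r (upd u k t)).
Proof.
  intros Hu.
  assert (P : 0 < r - Rabs (u k - c k)) by (specialize (Hu k); lra).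
  exists (mkposreal _ P); intros t Ht.
  apply box_upd; [exact Hu |].
  change (Rabs (t - u k) < r - Rabs (u k - c k)) in Ht.
  replace (t - c k) with ((t - u k) + (u k - c k)) by ring.
  eapply Rle_lt_trans; [apply Rabs_triang | lra].
Qed.

Definition indep (B : jet -> Prop) (k : nat) (h : jet -> C) : Prop :=
  forall u t, B u -> B (upd u k t) -> h (upd u k t) = h u.

Lemma partial_indep c r h k j u t :
  j <> k -> indep (box c r) k h -> box c r u -> box c r (upd u k t) ->
  partial j h (upd u k t) = partial j h u.
Proof.
  intros Hj Hi Hu Ht; unfold partial; rewrite upd_neq by exact Hj.
  assert (L : locally (u j) (fun s =>
      h (upd (upd u k t) j s) = h (upd u j s))).
  { eapply filter_imp; [| apply (box_locally c r u j Hu)]; intros s Hs.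
    rewrite upd_comm by exact Hj; apply Hi; [exact Hs |].
    apply box_upd; [exact Hs |]. now apply box_upd_inv in Ht. }
  f_equal; apply Derive_ext_loc; (eapply filter_imp; [| exact L]);
    intros s Hs; cbv beta in Hs |- *; now rewrite Hs.
Qed.

Lemma partial_indep_zero c r h k u :
  indep (box c r) k h -> box c r u -> partial k h u = 0%C.
Proof.
  intros Hi Hu; apply partial_of_Cder.
  apply (Cder_ext_loc (fun _ => h u)); [| apply Cder_const].
  eapply filter_imp; [| apply (box_locally c r u k Hu)]; intros t Ht.
  symmetry; now apply Hi.
Qed.

Lemma zero_derivative_eq (f : R -> R) a b :
  (forall x, Rmin a b <= x <= Rmax a b -> is_derive f x 0) -> f a = f b.
Proof.
  intros H; destruct (MVT_gen f a b (fun _ => 0)) as [x [_ E]].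
  - intros x Hx; apply H; lra.
  - intros x Hx; apply derivable_continuous_pt, ex_derive_Reals_0.
    exists 0; now apply H.
  - lra.
Qed.

Lemma between_Rabs a b c r x :
  Rabs (a - c) < r -> Rabs (b - c) < r -> Rmin a b <= x <= Rmax a b ->
  Rabs (x - c) < r.
Proof.
  intros Ha Hb; apply Rabs_def2 in Ha, Hb.
  unfold Rmin, Rmax; destruct (Rle_dec a b); intros Hx; apply Rabs_def1; lra.
Qed.

(** The mean value theorem, applied to real and imaginary part along the segment from [u k] to [t],
    which lies in the box. *)
Lemma indep_of_partial c r h k :
  (forall u, box c r u -> differentiable_in k h u) ->
  (forall u, box c r u -> partial k h u = 0%C) -> indep (box c r) k h.
Proof.
  intros Hd H0 u t Hu Ht.
  assert (I : forall x, Rmin (u k) t <= x <= Rmax (u k) t ->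
      Cder (fun s => h (upd u k s)) x 0%C).
  { intros x Hx.
    assert (Hv : box c r (upd u k x)).
    { apply box_upd; [exact Hu |].
      apply (between_Rabs (u k) t); trivial; now apply box_upd_inv in Ht. }
    pose proof (Cder_partial h k _ (Hd _ Hv)) as Hp.
    rewrite (H0 _ Hv), upd_eq in Hp.
    apply (Cder_ext_loc _ _ _ _ (filter_forall _ (fun s => f_equal h (upd_upd u k x s)))).
    exact Hp. }
  rewrite <- (upd_same u k) at 2; symmetry; apply injective_projections.
  - apply (zero_derivative_eq (fun s => fst (h (upd u k s)))).
    intros x Hx; apply (I x Hx).
  - apply (zero_derivative_eq (fun s => snd (h (upd u k s)))).
    intros x Hx; apply (I x Hx).
Qed.

(** Among the terms u_(k+1) dh/du_k with k <= n, only k = n contains u_(n+1), because the partial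
    derivatives inherit from [h] the independence of u_(n+1). *)
Lemma Dx_affine c r h n u t :
  (forall k, (n < k)%nat -> indep (box c r) k h) ->
  box c r u -> box c r (upd u (S n) t) ->
  Dx h (upd u (S n) t)
  = (Dx h u + (RtoC t - RtoC (u (S n))) * partial n h u)%C.
Proof.
  intros Hi Hu Ht.
  assert (Z : forall v, box c r v ->
      Dx h v = fsum (fun k => RtoC (v (S k)) * partial k h v)%C n).
  { intros v Hv; apply Csum_finite; intros k Hk.
    rewrite (partial_indep_zero c r h k v) by auto; ring. }
  rewrite !Z by assumption.
  assert (P : forall k, (k <= n)%nat -> partial k h (upd u (S n) t) = partial k h u).
  { intros k Hk; apply (partial_indep c r); auto; lia. }
  destruct n as [|n]; simpl.
  - rewrite upd_eq, P by lia; ring.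
  - rewrite upd_eq, P by lia.
    rewrite (fsum_ext _ (fun k => RtoC (u (S k)) * partial k h u)%C).
    + ring.
    + intros k Hk; rewrite upd_neq, P by lia; reflexivity.
Qed.

(** * Bounding the order of a primitive by the order of its total derivative *)

Section Descent.
Variables (Om : jet -> Prop) (at_ : nat -> jet -> C) (tab : nat -> nat -> expr).
Variables (c : jet) (r : posreal) (h : jet -> C) (q : expr).
Hypothesis HA : atoms Om at_ tab.
Hypothesis Hbox : forall u, box c r u -> Om u.
Hypothesis Hd : forall k u, box c r u -> differentiable_in k h u.
Hypothesis Hq : forall u, box c r u -> Dx h u = eval at_ q u.

Lemma d_primitive n u :
  (forall k, (n < k)%nat -> indep (box c r) k h) -> box c r u ->
  eval at_ (d tab (S n) q) u = partial n h u.
Proof.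
  intros Hi Hu.
  apply (Cder_unique (fun t => eval at_ q (upd u (S n) t)) (u (S n)));
    [apply (Cder_eval Om); auto |].
  apply (Cder_ext_loc (fun t =>
    Dx h u + (RtoC t + - RtoC (u (S n))) * partial n h u)%C).
  - eapply filter_imp; [| apply (box_locally c r u (S n) Hu)]; intros t Ht.
    rewrite <- Hq by exact Ht; symmetry; now apply (Dx_affine c r).
  - refine (Cder_eq _ _ _ _ _ (Cder_plus _ _ _ _ _ (Cder_const _ _)
      (Cder_mult _ _ _ _ _ (Cder_plus _ _ _ _ _
         (Cder_RtoC (fun t => t) _ _ (is_derive_id _)) (Cder_const _ _))
      (Cder_const _ _)))).
    change (RtoC one) with (RtoC 1); ring.
Qed.

Lemma d2_primitive n u :
  (forall k, (n < k)%nat -> indep (box c r) k h) -> box c r u ->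
  eval at_ (d tab (S n) (d tab (S n) q)) u = 0%C.
Proof.
  intros Hi Hu.
  apply (Cder_unique (fun t => eval at_ (d tab (S n) q) (upd u (S n) t)) (u (S n)));
    [apply (Cder_eval Om); auto |].
  apply (Cder_ext_loc (fun t => partial n h u)); [| apply Cder_const].
  eapply filter_imp; [| apply (box_locally c r u (S n) Hu)]; intros t Ht.
  rewrite d_primitive by assumption; symmetry.
  apply (partial_indep c r); auto.
Qed.

(** Downward induction from the bound [N] that finite order supplies. At a top order m > n the slope
    dh/du_m equals dq/du_(m+1), which is zero, so [h] has order below m. *)
Lemma order_descent n N :
  (forall u k, box c r u -> (S n < k)%nat -> eval at_ (d tab k q) u = 0%C) ->
  (forall k, (N < k)%nat -> indep (box c r) k h) ->
  forall k, (n < k)%nat -> indep (box c r) k h.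
Proof.
  intros Hz; induction N as [|N IH]; intros HN k Hk; [apply HN; lia |].
  destruct (Compare_dec.le_lt_dec N n) as [Hn | Hn].
  - destruct (Nat.eq_dec k (S N)) as [E |]; [| apply HN; lia].
    assert (n = N) as -> by lia; subst k.
    apply indep_of_partial; [auto |]; intros u Hu.
    rewrite <- d_primitive by assumption; apply Hz; auto.
  - apply IH; [| exact Hk]; intros j Hj.
    destruct (Nat.eq_dec j (S N)) as [-> |]; [| apply HN; lia].
    apply indep_of_partial; [auto |]; intros u Hu.
    rewrite <- d_primitive by assumption; apply Hz; auto; lia.
Qed.

End Descent.

Lemma indep_of_finite_order (Om : jet -> Prop) c r h :
  finite_order Om h -> (forall u, box c r u -> Om u) ->
  exists N, forall k, (N < k)%nat -> indep (box c r) k h.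
Proof.
  intros [N HN] Hb; exists N; intros k Hk u t Hu Ht.
  apply HN; auto; intros j Hj; apply upd_neq; lia.
Qed.

(** [Dx] is a series, so additivity is obtained from a common truncation: beyond [M] the partial
    derivatives of [h], of [e] and of the difference all vanish. *)
Lemma Dx_minus_eval (Om : jet -> Prop) at_ tab c r h e u :
  atoms Om at_ tab -> (forall u, box c r u -> Om u) ->
  finite_order Om h -> (forall k, differentiable_in k h u) -> box c r u ->
  Dx (fun v => h v - eval at_ e v)%C u = (Dx h u - eval at_ (Dt tab e) u)%C.
Proof.
  intros HA Hb Hf Hd Hu.
  destruct (indep_of_finite_order Om c r h Hf Hb) as [N HN].
  rewrite <- (eval_D Om) by auto; unfold Dx.
  set (M := Nat.max N (ord e)).
  assert (Hh : forall k, (M < k)%nat -> partial k h u = 0%C).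
  { intros k Hk; apply (partial_indep_zero c r); trivial; apply HN; lia. }
  assert (He : forall k, (M < k)%nat -> partial k (eval at_ e) u = 0%C).
  { intros k Hk; rewrite (partial_eval Om at_ tab) by auto.
    apply (eval_d_ord Om); auto; lia. }
  assert (Hm : forall k, partial k (fun v => h v - eval at_ e v)%C u
      = (partial k h u + - partial k (eval at_ e) u)%C).
  { intros k; apply partial_of_Cder, Cder_plus; [now apply Cder_partial |].
    rewrite (partial_eval Om at_ tab) by auto.
    apply Cder_opp, (Cder_eval Om); auto. }
  rewrite !(Csum_finite _ M).
  - unfold Cminus; rewrite <- fsum_opp, <- fsum_plus.
    apply fsum_ext; intros k _; rewrite Hm; ring.
  - intros k Hk; rewrite He by exact Hk; ring.
  - intros k Hk; rewrite Hh by exact Hk; ring.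
  - intros k Hk; rewrite Hm, He, Hh by exact Hk; ring.
Qed.

(* Unless [h - e] has order at most [n], the slope of its total derivative in the
   next jet variable is nonzero; in a box this lowers the order step by step. *)
Lemma total_derivative_affine (Om : jet -> Prop) at_ tab (g : jet -> C) e q n u :
  open Om -> atoms Om at_ tab -> zero_functional Om g ->
  (forall v, Om v -> g v = eval at_ (Dt tab e) v + eval at_ q v)%C ->
  (forall v k, Om v -> (S n < k)%nat -> eval at_ (d tab k q) v = 0%C) ->
  Om u -> eval at_ (d tab (S n) (d tab (S n) q)) u = 0%C.
Proof.
  intros HO HA [h [[Hf Hs] Hh]] Hg Hz Hu.
  destruct (box_sub Om u HO Hu) as [r Hr].
  set (h' := fun v => (h v - eval at_ e v)%C).
  assert (Hd' : forall k v, box u r v -> differentiable_in k h' v).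
  { intros k v Hv; eapply differentiable_of_Cder, Cder_plus;
      [apply Cder_partial, (Hs nil); auto |].
    apply Cder_opp, (Cder_eval Om at_ tab); auto. }
  assert (Hq : forall v, box u r v -> Dx h' v = eval at_ q v).
  { intros v Hv; unfold h'; rewrite (Dx_minus_eval Om at_ tab u r); auto.
    - rewrite <- Hh, Hg by auto; ring.
    - intros k; apply (Hs nil); auto. }
  destruct (indep_of_finite_order Om u r h') as [N HN]; auto.
  { destruct Hf as [N1 H1].
    destruct (eval_finite_order Om at_ tab e HA) as [N2 H2].
    exists (Nat.max N1 N2); intros v w' Hv Hw E; unfold h'.
    rewrite (H1 v w'), (H2 v w'); auto; intros k Hk; apply E; lia. }
  apply (d2_primitive Om at_ tab u r h' q); auto using box_center.
  (* The remaining premise of [d2_primitive] is that h' has order at most [n]. *)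
  apply (order_descent Om at_ tab u r h' q) with (N := N); auto.
Qed.

(** * Functions given by their logarithmic derivatives *)

Lemma RtoC_neq_0 (x : R) : x <> 0 -> RtoC x <> 0%C.
Proof. intros H E; apply H; now injection E. Qed.

(** [r u k] plays the part of the derivative of log F with respect to u_k. The condition is written
    without division, so that the zero function, the default entry of an atom list, also satisfies
    it. *)
Record logarithmic (Om : jet -> Prop) (F : jet -> C) (r : jet -> nat -> C) : Prop := {
  log_finite_order : finite_order Om F;
  log_continuous : forall u, Om u -> continuous F u;
  log_derive : forall u k, Om u ->
    Cder (fun t => F (upd u k t)) (u k) (F u * r u k)%C
}.

Lemma log_ext Om F G r s :
  open Om -> logarithmic Om F r -> (forall u, Om u -> G u = F u) ->
  (forall u k, Om u -> s u k = r u k) -> logarithmic Om G s.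
Proof.
  intros HO [Ff Fc Fd] E Er; split.
  - destruct Ff as [n Hn]; exists n; intros u v Hu Hv A; rewrite !E; auto.
  - intros u Hu; apply (continuous_ext_loc _ F); [| auto].
    eapply filter_imp; [| apply (HO u Hu)]; intros v Hv; symmetry; auto.
  - intros u k Hu; rewrite E, Er by exact Hu.
    apply (Cder_ext_loc (fun t => F (upd u k t))); [| auto].
    eapply filter_imp; [| apply (upd_locally Om u k HO Hu)]; intros t Ht.
    symmetry; auto.
Qed.

Lemma log_mult Om F G r s :
  logarithmic Om F r -> logarithmic Om G s ->
  logarithmic Om (fun u => F u * G u)%C (fun u k => r u k + s u k)%C.
Proof.
  intros [[n Hn] Fc Fd] [[m Hm] Gc Gd]; split.
  - exists (Nat.max n m); intros u v Hu Hv A.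
    rewrite (Hn u v), (Hm u v); auto; intros k Hk; apply A; lia.
  - intros u Hu; apply continuous_Cmult; auto.
  - intros u k Hu; pose proof (Cder_mult _ _ _ _ _ (Fd u k Hu) (Gd u k Hu)) as H.
    cbv beta in H; rewrite upd_same in H.
    refine (Cder_eq _ _ _ _ _ H); ring.
Qed.

Lemma log_const Om c : logarithmic Om (fun _ => c) (fun _ _ => 0%C).
Proof.
  split.
  - exists O; reflexivity.
  - intros; apply continuous_const.
  - intros; refine (Cder_eq _ _ _ _ _ (Cder_const _ _)); ring.
Qed.

Lemma log_pow Om F r n :
  logarithmic Om F r ->
  logarithmic Om (fun u => Cpow (F u) n) (fun u k => RtoC (INR n) * r u k)%C.
Proof.
  intros HF; induction n as [|n IH].
  - destruct (log_const Om 1) as [Hf Hc Hd]; split; auto.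
    intros u k Hu; refine (Cder_eq _ _ _ _ _ (Hd u k Hu)); simpl; ring.
  - destruct (log_mult Om _ _ _ _ HF IH) as [Hf Hc Hd]; split; auto.
    intros u k Hu; refine (Cder_eq _ _ _ _ _ (Hd u k Hu)).
    rewrite S_INR, RtoC_plus; simpl; ring.
Qed.

Lemma log_real Om (s : jet -> R) (r : jet -> nat -> R) :
  (exists n, forall u v, agree n u v -> s u = s v) ->
  (forall u, continuous s u) ->
  (forall u k, Om u -> is_derive (fun t => s (upd u k t)) (u k) (s u * r u k)) ->
  logarithmic Om (fun u => RtoC (s u)) (fun u k => RtoC (r u k)).
Proof.
  intros [n Hn] Hc Hd; split.
  - exists n; intros u v _ _ A; now rewrite (Hn u v).
  - intros u _; apply continuous_pair; [apply Hc | apply continuous_const].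
  - intros u k Hu; rewrite <- RtoC_mult; now apply Cder_RtoC, Hd.
Qed.

(** Real and complex inverse both give 0 at 0, so this rewriting has no side condition and may be
    used off the domain as well. *)
Lemma Cinv_RtoC (x : R) : (/ RtoC x)%C = RtoC (/ x).
Proof.
  destruct (Req_dec x 0) as [-> | H]; [| now rewrite RtoC_inv].
  apply injective_projections; simpl; rewrite ?Rinv_0; unfold Rdiv; ring.
Qed.

Lemma log_real_inv Om (s : jet -> R) (r : jet -> nat -> R) :
  (forall u, Om u -> s u <> 0) ->
  (exists n, forall u v, agree n u v -> s u = s v) ->
  (forall u, continuous s u) ->
  (forall u k, Om u -> is_derive (fun t => s (upd u k t)) (u k) (s u * r u k)) ->
  logarithmic Om (fun u => / RtoC (s u))%C (fun u k => - RtoC (r u k))%C.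
Proof.
  intros H0 [n Hn] Hc Hd.
  assert (E : forall u, (/ RtoC (s u))%C = RtoC (/ s u)) by (intros; apply Cinv_RtoC).
  split.
  - exists n; intros u v _ _ A; now rewrite (Hn u v).
  - intros u Hu; apply (continuous_ext (fun v => RtoC (/ s v))); [now intros; rewrite E |].
    apply continuous_pair; [| apply continuous_const].
    apply (continuous_comp s Rinv); [apply Hc |].
    apply continuous_Rinv, H0, Hu.
  - intros u k Hu.
    apply (Cder_ext_loc (fun t => RtoC (/ s (upd u k t))));
      [apply filter_forall; now intros; rewrite E |].
    rewrite E, <- RtoC_opp, <- RtoC_mult; apply Cder_RtoC.
    eapply is_derive_eq; [| apply is_derive_inv; [now apply Hd |]].
    + cbv beta; rewrite upd_same; field; auto.
    + cbv beta; rewrite upd_same; auto.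
Qed.

(** Differentiating [Cexp (L u) = s u] gives s dL/du_k = s r, and s, being an exponential, is
    nonzero. Thus all branches [L] share the derivative [r], and the exponent merely multiplies
    it. *)
Lemma log_power Om s r a p :
  open Om -> logarithmic Om (fun u => RtoC (s u)) r -> power_branch Om s a p ->
  logarithmic Om p (fun u k => a * r u k)%C.
Proof.
  intros HO [_ _ Sd] [L [[[n Hn] HL] [HE Hp]]].
  assert (H : logarithmic Om (fun u => Cexp (a * L u)%C) (fun u k => a * r u k)%C).
  { split.
    - exists n; intros u v Hu Hv A; now rewrite (Hn u v).
    - intros u Hu; apply continuous_Cexp, continuous_Cmult;
        [apply continuous_const | apply (HL nil u Hu)].
    - intros u k Hu.
      pose proof (Cder_partial L k u (proj2 (HL nil u Hu) k)) as Ld.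
      pose proof (Cder_Cexp _ _ _ Ld) as Ed; cbv beta in Ed.
      rewrite upd_same, HE in Ed by exact Hu.
      assert (N : RtoC (s u) <> 0%C).
      { rewrite <- HE by exact Hu; intros Z; injection Z; intros Z2 Z1.
        pose proof (sin2_cos2 (snd (L u))) as T; unfold Rsqr in T.
        pose proof (exp_pos (fst (L u))) as P.
        apply Rmult_integral in Z1, Z2.
        destruct Z1 as [Z1|Z1]; [lra |]; destruct Z2 as [Z2|Z2]; [lra |].
        rewrite Z1, Z2 in T; lra. }
      assert (El : partial k L u = r u k).
      { assert (E : (RtoC (s u) * partial k L u = RtoC (s u) * r u k)%C).
        { eapply Cder_unique; [exact Ed |].
          apply (Cder_ext_loc (fun t => RtoC (s (upd u k t)))); [| now apply Sd].
          eapply filter_imp; [| apply (upd_locally Om u k HO Hu)]; intros t Ht.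
          now rewrite HE. }
        replace (partial k L u) with (/ RtoC (s u) * (RtoC (s u) * partial k L u))%C
          by (field; exact N).
        rewrite E; field; exact N. }
      rewrite El in Ld.
      pose proof (Cder_Cexp _ _ _ (Cder_mult _ _ _ _ _ (Cder_const a (u k)) Ld)) as R.
      cbv beta in R; rewrite upd_same in R.
      refine (Cder_eq _ _ _ _ _ R); ring. }
  apply (log_ext Om _ _ _ _ HO H); auto.
Qed.

(** * The complex exponential and branches of powers *)

Lemma Cexp_plus x y : Cexp (x + y)%C = (Cexp x * Cexp y)%C.
Proof.
  apply injective_projections; simpl;
    rewrite exp_plus, ?cos_plus, ?sin_plus; ring.
Qed.

Lemma Cexp_0 : Cexp 0%C = 1%C.
Proof.
  apply injective_projections; simpl; rewrite exp_0, ?cos_0, ?sin_0; ring.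
Qed.

Lemma Cexp_neq_0 x : Cexp x <> 0%C.
Proof.
  intros E; assert (H : (Cexp x * Cexp (- x) = 1)%C).
  { rewrite <- Cexp_plus, Cplus_opp_r; apply Cexp_0. }
  rewrite E, Cmult_0_l in H; injection H; lra.
Qed.

Lemma Cexp_opp x : Cexp (- x)%C = (/ Cexp x)%C.
Proof.
  assert (H : (Cexp x * Cexp (- x) = 1)%C).
  { rewrite <- Cexp_plus, Cplus_opp_r; apply Cexp_0. }
  replace (Cexp (- x)%C) with (/ Cexp x * (Cexp x * Cexp (- x)))%C
    by (field; apply Cexp_neq_0).
  rewrite H; ring.
Qed.

Lemma power_branch_neq_0 Om s a p u :
  power_branch Om s a p -> Om u -> p u <> 0%C /\ s u <> 0.
Proof.
  intros [L [_ [HE Hp]]] Hu; split.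
  - rewrite Hp by exact Hu; apply Cexp_neq_0.
  - intros Z; apply (Cexp_neq_0 (L u)); rewrite HE by exact Hu; now rewrite Z.
Qed.

Lemma power_branch_inv Om s a p :
  power_branch Om s a p -> power_branch Om s (- a)%C (fun u => / p u)%C.
Proof.
  intros [L [HL [HE Hp]]]; exists L; split; [exact HL |]; split; [exact HE |].
  intros u Hu; rewrite Hp, <- Cexp_opp by exact Hu; f_equal; ring.
Qed.

(** An integer exponent erases the choice of branch, exp(2L) being (exp L)^2. This is what makes g =
    m w^2 possible at gamma = 2. *)
Lemma power_branch_2 Om s p u :
  power_branch Om s 2 p -> Om u -> p u = (RtoC (s u) * RtoC (s u))%C.
Proof.
  intros [L [_ [HE Hp]]] Hu; rewrite Hp, <- HE, <- Cexp_plus by exact Hu.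
  f_equal; ring.
Qed.

(** * Logarithmic derivatives of the coordinates and of w *)

(** The logarithmic derivative of u_j with respect to u_k; [rw] is the same for [w]. *)
Definition rcoord (j : nat) (u : jet) (k : nat) : R :=
  if Nat.eqb k j then / u j else 0.

Definition rw (u : jet) (k : nat) : R :=
  match k with
  | 1%nat => u 3%nat / w u
  | 2%nat => - 8 * u 2%nat / w u
  | 3%nat => u 1%nat / w u
  | _ => 0
  end.

Lemma coord_derive j u k :
  u j <> 0 -> is_derive (fun t => upd u k t j) (u k) (u j * rcoord j u k).
Proof.
  intros H; unfold upd, rcoord; rewrite Nat.eqb_sym.
  destruct (Nat.eqb_spec k j) as [-> |].
  - rewrite Rinv_r by exact H; apply @is_derive_id.
  - rewrite Rmult_0_r; apply @is_derive_const.
Qed.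

Lemma w_derive u k :
  w u <> 0 -> is_derive (fun t => w (upd u k t)) (u k) (w u * rw u k).
Proof.
  intros H; destruct k as [|[|[|[|k]]]]; unfold rw;
    (eapply is_derive_eq; [| unfold w, upd; simpl; auto_derive; [exact I | reflexivity]]).
  all: try (field; exact H); ring.
Qed.

Lemma w_continuous (u : jet) : continuous w u.
Proof.
  apply (@continuous_minus _ R_AbsRing R_NormedModule).
  - apply (@continuous_mult _ R_AbsRing); apply continuous_coord.
  - apply (@continuous_mult _ R_AbsRing); [apply continuous_const |].
    apply (@continuous_mult _ R_AbsRing); [apply continuous_coord |].
    apply (@continuous_mult _ R_AbsRing); [apply continuous_coord | apply continuous_const].
Qed.

Lemma w_finite_order : exists n, forall u v, agree n u v -> w u = w v.
Proof.
  exists 3%nat; intros u v A; unfold w.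
  now rewrite (A 1%nat), (A 2%nat), (A 3%nat) by lia.
Qed.

Lemma coord_finite_order j : exists n, forall u v : jet, agree n u v -> u j = v j.
Proof. exists j; intros u v A; apply A; lia. Qed.

Lemma log_coord Om j :
  (forall u, Om u -> u j <> 0) ->
  logarithmic Om (fun u => RtoC (u j)) (fun u k => RtoC (rcoord j u k)).
Proof.
  intros H; apply (log_real Om (fun u => u j));
    [apply coord_finite_order | apply continuous_coord |].
  intros u k Hu; apply coord_derive; auto.
Qed.

Lemma log_coord_inv (Om : jet -> Prop) j :
  (forall u, Om u -> u j <> 0) ->
  logarithmic Om (fun u => / RtoC (u j))%C (fun u k => - RtoC (rcoord j u k))%C.
Proof.
  intros H; apply (log_real_inv Om (fun u => u j));
    [exact H | apply coord_finite_order | apply continuous_coord |].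
  intros u k Hu; apply coord_derive; auto.
Qed.

Lemma log_w Om :
  (forall u, Om u -> w u <> 0) ->
  logarithmic Om (fun u => RtoC (w u)) (fun u k => RtoC (rw u k)).
Proof.
  intros H; apply (log_real Om w); [apply w_finite_order | apply w_continuous |].
  intros u k Hu; apply w_derive; auto.
Qed.

Lemma log_w_inv (Om : jet -> Prop) :
  (forall u, Om u -> w u <> 0) ->
  logarithmic Om (fun u => / RtoC (w u))%C (fun u k => - RtoC (rw u k))%C.
Proof.
  intros H; apply (log_real_inv Om w);
    [exact H | apply w_finite_order | apply w_continuous |].
  intros u k Hu; apply w_derive; auto.
Qed.

(** * Lists of atoms with their logarithmic derivatives *)

(** Indices past the end of a list denote the zero function, matching the entry [Rat 0] that the
    tables return there. *)
Definition no_atom : (jet -> C) * (jet -> nat -> C) :=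
  (fun _ => RtoC 0, fun _ _ => RtoC 0).

Definition atom (l : list ((jet -> C) * (jet -> nat -> C))) (i : nat) : jet -> C :=
  fst (nth i l no_atom).

Definition log_atom (l : list ((jet -> C) * (jet -> nat -> C))) (i : nat) :=
  snd (nth i l no_atom).

Lemma atoms_of_logarithmic Om l tab :
  List.Forall (fun F => logarithmic Om (fst F) (snd F)) l ->
  (forall i k u, Om u -> eval (atom l) (tab k i) u = (atom l i u * log_atom l i u k)%C) ->
  (forall i k u, Om u -> (3 < k)%nat -> log_atom l i u k = 0%C) ->
  atoms Om (atom l) tab.
Proof.
  intros Hl Ht Ho.
  assert (HL : forall i, logarithmic Om (atom l i) (log_atom l i)).
  { intros i; unfold atom, log_atom; destruct (nth_in_or_default i l no_atom) as [H | ->].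
    - exact (proj1 (Forall_forall _ _) Hl _ H).
    - apply (log_const Om 0). }
  split.
  - intros i; apply (log_finite_order _ _ _ (HL i)).
  - intros i; apply (log_continuous _ _ _ (HL i)).
  - intros i u k Hu; rewrite Ht by exact Hu; now apply (log_derive _ _ _ (HL i)).
  - intros i u k Hu Hk; rewrite Ht, Ho by assumption; ring.
Qed.

Lemma Cmult_eq_0 (x y : C) : (x * y = 0)%C -> x = 0%C \/ y = 0%C.
Proof.
  intros H; destruct (Ceq_dec x 0) as [|Hx]; [now left |].
  destruct (Ceq_dec y 0) as [|Hy]; [now right |].
  now elim (Cmult_neq_0 x y Hx Hy).
Qed.

Fixpoint spow (e : expr) (n : nat) : expr :=
  match n with O => Rat 1 | S m => (spow e m * e)%E end.
Notation "e ^ n" := (spow e n) : expr_scope.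

Definition W : expr := (Var 1 * Var 3 - Rat 4 * Var 2 ^ 2)%E.

Lemma RtoC_w u :
  RtoC (w u) = (RtoC (u 1%nat) * RtoC (u 3%nat) - 4 * RtoC (u 2%nat) ^ 2)%C.
Proof. unfold w; now rewrite RtoC_minus, !RtoC_mult, RtoC_pow. Qed.

Lemma eval_W at_ u : eval at_ W u = RtoC (w u).
Proof. rewrite RtoC_w; cbn; field. Qed.

(* Real constants must stay out of [Cst], where [vm_compute] would unfold them. *)
Ltac expand_evals :=
  repeat match goal with
  | |- context [eval ?a ?e ?u] =>
     let e' := eval vm_compute in e in
     let r := eval cbn [eval Qnum Qden] in (eval a e' u) in
     change (eval a e u) with r
  end.

(** The logarithmic derivative of u_1^a u_2^b. *)
Definition rlin (a b : C) (u : jet) (k : nat) : C :=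
  (a * RtoC (rcoord 1 u k) + b * RtoC (rcoord 2 u k))%C.

(** * The case gamma = 2 *)

(* The atoms are 1/u_1, 1/u_2, f and m, where g = m w^2. *)
Definition tab_w2 (al be : C) (k i : nat) : expr :=
 (match i, k with
  | 0%nat, 1%nat => - (At 0 * At 0)
  | 1%nat, 2%nat => - (At 1 * At 1)
  | 2%nat, 1%nat => (Rat 2 - Rat 4 * Cst al) * At 2 * At 0
  | 2%nat, 2%nat => Cst al * At 2 * At 1
  | 3%nat, 1%nat => (Rat (-12) - Rat 4 * Cst be) * At 3 * At 0
  | 3%nat, 2%nat => Cst be * At 3 * At 1
  | _, _ => Rat 0
  end)%E.

(** The exponents are those of f = u_1^(2-4 alpha) u_2^alpha and m = u_1^(-12-4 beta) u_2^beta; the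
    -12 is 2 - 14, the 14 coming from the square of u_1^7 in [base2]. *)
Definition atoms_w2 (al be : C) (f m : jet -> C) :=
  ((fun u : jet => / RtoC (u 1%nat), fun u k => - RtoC (rcoord 1 u k))
   :: (fun u : jet => / RtoC (u 2%nat), fun u k => - RtoC (rcoord 2 u k))
   :: (f, rlin (2 - 4 * al) al)
   :: (m, rlin (-12 - 4 * be) be) :: nil)%C.

(* Found by integrating the coefficients successively in u_4, u_3 and u_2. *)
Definition primitive_w2 (al : C) : expr :=
  let a := Cst al in let x := At 0 in let y := At 1 in
  ((a - Rat 1) * At 2 * At 3 *
   (x ^ 2 * (Rat (2#3) * (Rat 84 * a ^ 2 - Rat 383 * a + Rat 13) * W ^ 2
     + Rat (2#3) * a * (Rat 37 * a - Rat 71) * W ^ 3 * y ^ 2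
     - Rat (1#36) * a * (a - Rat 2) * (Rat 37 * a - Rat 71) * W ^ 4 * y ^ 4
     - Rat 56 * (Rat 12 * a - Rat 1) * Var 2 ^ 2 * W
     - Rat 112 * (Rat 7 * a - Rat 1) * Var 2 ^ 4)
    + Var 4 * (Rat 4 * (Rat 14 * a - Rat 1) * Var 2 + Rat 24 * a * W * y
                - Rat 2 * a * (a - Rat 2) * W ^ 2 * y ^ 3)
    - a * Var 1 ^ 2 * y ^ 2 * Var 4 ^ 2))%E.

(** The roots 0 and 1 are excluded by the hypothesis of the theorem; the other three are the values
    of alpha in its list. *)
Definition defect (al : C) : C :=
  (al * (al - 1) * (al + 1) * (al - 2) * (2 * al - 1))%C.

Definition remainder_w2 (c : C) : expr :=
  (Cst c * Rat (-1 # 54) * At 2 * At 3 * W ^ 5 * At 0 ^ 3 * At 1 ^ 5)%E.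

Lemma rcoord_far j u k : (j < k)%nat -> rcoord j u k = 0.
Proof. intros H; unfold rcoord; destruct (Nat.eqb_spec k j); [lia | reflexivity]. Qed.

Ltac unfold_table :=
  unfold atom, log_atom; cbn; unfold rlin, rcoord, rw; cbn;
  rewrite ?Cinv_RtoC, ?RtoC_opp; unfold Rdiv; rewrite ?RtoC_mult, <- ?Cinv_RtoC.

Lemma atoms_w2_ok (Om : jet -> Prop) (al be : C) (f m : jet -> C) :
  (forall u, Om u -> u 1%nat <> 0) -> (forall u, Om u -> u 2%nat <> 0) ->
  logarithmic Om f (rlin (2 - 4 * al) al) ->
  logarithmic Om m (rlin (-12 - 4 * be) be) ->
  atoms Om (atom (atoms_w2 al be f m)) (tab_w2 al be).
Proof.
  intros H1 H2 Hf Hm; apply atoms_of_logarithmic.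
  - repeat apply List.Forall_cons; trivial; now apply log_coord_inv.
  - intros i k u Hu; pose proof (RtoC_neq_0 _ (H1 u Hu)); pose proof (RtoC_neq_0 _ (H2 u Hu)).
    destruct i as [|[|[|[|i]]]]; destruct k as [|[|[|k]]]; unfold_table;
      try (destruct i); unfold no_atom; cbn [fst snd]; field; auto.
  - intros i k u Hu Hk.
    destruct i as [|[|[|[|i]]]]; unfold log_atom; cbn [nth atoms_w2 snd]; unfold rlin;
      rewrite ?rcoord_far by lia; try ring.
    destruct i; reflexivity.
Qed.

(** Once the table has eliminated all derivatives, both sides are [f u * m u] times a rational
    function of alpha and the jet variables up to u_5. *)
Lemma bracket_w2 (al be : C) (f m : jet -> C) u :
  u 1%nat <> 0 -> u 2%nat <> 0 -> (3 * be = 5 * al - 10)%C ->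
  let at_ := atom (atoms_w2 al be f m) in
  let tab := tab_w2 al be in
  (eval at_ (vd tab (At 2)) u * eval at_ (idv tab (At 3 * W ^ 2)%E) u)%C
  = (eval at_ (Dt tab (primitive_w2 al)) u + eval at_ (remainder_w2 (defect al)) u)%C.
Proof.
  intros H1 H2 Hb at_ tab.
  apply RtoC_neq_0 in H1, H2.
  assert (E : be = ((5 * al - 10) / 3)%C).
  { rewrite <- Hb; field. }
  (* [defect al] is hidden behind a variable, and [be] is substituted only at the end, so that
     normalising the expressions meets no arithmetic on constants. *)
  generalize (eq_refl (defect al)); unfold defect at 1.
  generalize (defect al); intros c Hc.
  unfold tab; expand_evals.
  change (at_ 0%nat u) with (/ RtoC (u 1%nat))%C.
  change (at_ 1%nat u) with (/ RtoC (u 2%nat))%C.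
  clear Hb; subst be c; field; auto.
Qed.

(** [w] is affine in u_3 with slope u_1, and f, m are free of u_3. So w^5 yields 20 u_1^2 w^3, and
    20 times -1/54 is -10/27. *)
Lemma d33_remainder_w2 (al be : C) (f m : jet -> C) u (c : C) :
  u 1%nat <> 0 -> u 2%nat <> 0 -> 
  let at_ := atom (atoms_w2 al be f m) in
  let tab := tab_w2 al be in
  eval at_ (d tab 3 (d tab 3 (remainder_w2 c))) u
  = (- (10 / 27) * c * f u * m u * RtoC (w u) ^ 3 / (RtoC (u 1%nat) * RtoC (u 2%nat) ^ 5))%C.
Proof.
  intros H1 H2 at_ tab.
  apply RtoC_neq_0 in H1, H2.
  rewrite RtoC_w.
  unfold tab; expand_evals.
  change (at_ 0%nat u) with (/ RtoC (u 1%nat))%C.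
  change (at_ 1%nat u) with (/ RtoC (u 2%nat))%C.
  change (at_ 2%nat u) with (f u).
  change (at_ 3%nat u) with (m u).
  field; auto.
Qed.

Lemma commute_w2_sufficient (Om : jet -> Prop) (al be : C) (f g m : jet -> C) :
  open Om -> (forall u, Om u -> u 1%nat <> 0) -> (forall u, Om u -> u 2%nat <> 0) ->
  logarithmic Om f (rlin (2 - 4 * al) al) ->
  logarithmic Om m (rlin (-12 - 4 * be) be) ->
  (forall u, Om u -> g u = m u * RtoC (w u) ^ 2)%C ->
  (3 * be = 5 * al - 10)%C -> defect al = 0%C -> commute Om f g.
Proof.
  intros HO H1 H2 Hf Hm Hg Hb Hc.
  apply (commute_of_primitive Om (atom (atoms_w2 al be f m)) (tab_w2 al be) f g
           (At 2) (At 3 * W ^ 2)%E (primitive_w2 al)); trivial.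
  - now apply atoms_w2_ok.
  - intros u Hu; rewrite Hg, <- (eval_W (atom (atoms_w2 al be f m))) by exact Hu.
    rewrite eval_mul; cbn [spow]; rewrite !eval_mul, Rat_1.
    cbn; ring.
  - intros u Hu; rewrite bracket_w2 by auto; rewrite Hc.
    unfold remainder_w2; rewrite !eval_mul; cbn [eval]; ring.
Qed.

Lemma commute_w2_necessary (Om : jet -> Prop) (al be : C) (f g m : jet -> C) :
  open Om -> (exists u, Om u) ->
  (forall u, Om u -> u 1%nat <> 0) -> (forall u, Om u -> u 2%nat <> 0) ->
  (forall u, Om u -> w u <> 0) ->
  (forall u, Om u -> f u <> 0%C) -> (forall u, Om u -> m u <> 0%C) ->
  logarithmic Om f (rlin (2 - 4 * al) al) ->
  logarithmic Om m (rlin (-12 - 4 * be) be) ->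
  (forall u, Om u -> g u = m u * RtoC (w u) ^ 2)%C ->
  (3 * be = 5 * al - 10)%C -> commute Om f g -> defect al = 0%C.
Proof.
  intros HO [u Hu] H1 H2 Hw Nf Nm Hf Hm Hg Hb Hz.
  assert (HA : atoms Om (atom (atoms_w2 al be f m)) (tab_w2 al be))
    by now apply atoms_w2_ok.
  assert (E : forall v, Om v -> g v = eval (atom (atoms_w2 al be f m)) (At 3 * W ^ 2)%E v).
  { intros v Hv; rewrite Hg, <- (eval_W (atom (atoms_w2 al be f m))) by exact Hv.
    rewrite eval_mul; cbn [spow]; rewrite !eval_mul, Rat_1.
    cbn; ring. }
  assert (Z : eval (atom (atoms_w2 al be f m))
     (d (tab_w2 al be) 3 (d (tab_w2 al be) 3 (remainder_w2 (defect al)))) u = 0%C).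
  (* The remainder has order 3, so a primitive of it has order at most 2. *)
  { apply (total_derivative_affine Om _ _ (bracket f g) (primitive_w2 al) _ 2 u);
      trivial.
    - intros v Hv; rewrite <- bracket_w2 by auto.
      apply (bracket_eval Om); trivial.
    - intros v k Hv Hk; apply (eval_d_ord Om); [exact HA | exact Hv | exact Hk]. }
  rewrite d33_remainder_w2 in Z by auto.
  pose proof (RtoC_neq_0 _ (H1 u Hu)) as C1.
  pose proof (RtoC_neq_0 _ (H2 u Hu)) as C2.
  pose proof (RtoC_neq_0 _ (Hw u Hu)) as C3.
  (* The formula of [d33_remainder_w2], solved for the constant factor. *)
  replace (defect al) with
    (- (27 / 10) * (- (10 / 27) * defect al * f u * m u * RtoC (w u) ^ 3 / (RtoC (u 1%nat) * RtoC (u 2%nat) ^ 5)) / (f u * m u) / (RtoC (w u)) ^ 3 * (RtoC (u 1%nat) * RtoC (u 2%nat) ^ 5))%C.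
  - rewrite Z; unfold Cdiv; ring.
  - field; repeat split; solve [assumption | exact (Nf u Hu) | exact (Nm u Hu)].
Qed.

(** Needed for one more derivative in u_4: the affine criterion makes the second derivative of the
    remainder vanish on all of [Om], hence also the third. *)
Lemma eval_d_zero Om at_ tab e k u :
  open Om -> atoms Om at_ tab -> (forall v, Om v -> eval at_ e v = 0%C) -> Om u ->
  eval at_ (d tab k e) u = 0%C.
Proof.
  intros HO HA Hz Hu.
  apply (Cder_unique (fun t => eval at_ e (upd u k t)) (u k));
    [now apply (Cder_eval Om) |].
  apply (Cder_ext_loc (fun _ => RtoC 0)); [| apply Cder_const].
  eapply filter_imp; [| apply (upd_locally Om u k HO Hu)]; intros t Ht.
  symmetry; auto.
Qed.

(** * General gamma *)

(* The atoms are 1/u_1, 1/u_2, 1/w, f and g. *)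
Definition tab_w (al be ga : C) (k i : nat) : expr :=
 (match i, k with
  | 0%nat, 1%nat => - (At 0 * At 0)
  | 1%nat, 2%nat => - (At 1 * At 1)
  | 2%nat, 1%nat => - (At 2 * At 2) * Var 3
  | 2%nat, 2%nat => At 2 * At 2 * Rat 8 * Var 2
  | 2%nat, 3%nat => - (At 2 * At 2 * Var 1)
  | 3%nat, 1%nat => (Rat 2 - Rat 4 * Cst al) * At 3 * At 0
  | 3%nat, 2%nat => Cst al * At 3 * At 1
  | 4%nat, 1%nat => ((Rat 2 - Rat 4 * Cst be - Rat 7 * Cst ga) * At 0
                     + Cst ga * Var 3 * At 2) * At 4
  | 4%nat, 2%nat => (Cst be * At 1 - Cst ga * Rat 8 * Var 2 * At 2) * At 4
  | 4%nat, 3%nat => Cst ga * Var 1 * At 2 * At 4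
  | _, _ => Rat 0
  end)%E.

(** The logarithmic derivative of u_1^a u_2^b w^c. *)
Definition rlinw (a b c : C) (u : jet) (k : nat) : C :=
  (rlin a b u k + c * RtoC (rw u k))%C.

Definition atoms_w (al be ga : C) (f g : jet -> C) :=
  ((fun u : jet => / RtoC (u 1%nat), fun u k => - RtoC (rcoord 1 u k))
   :: (fun u : jet => / RtoC (u 2%nat), fun u k => - RtoC (rcoord 2 u k))
   :: (fun u : jet => / RtoC (w u), fun u k => - RtoC (rw u k))
   :: (f, rlin (2 - 4 * al) al)
   :: (g, rlinw (2 - 4 * be - 7 * ga) be ga) :: nil)%C.

Lemma atoms_w_ok (Om : jet -> Prop) (al be ga : C) (f g : jet -> C) :
  (forall u, Om u -> u 1%nat <> 0) -> (forall u, Om u -> u 2%nat <> 0) ->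
  (forall u, Om u -> w u <> 0) ->
  logarithmic Om f (rlin (2 - 4 * al) al) ->
  logarithmic Om g (rlinw (2 - 4 * be - 7 * ga) be ga) ->
  atoms Om (atom (atoms_w al be ga f g)) (tab_w al be ga).
Proof.
  intros H1 H2 Hw Hf Hg; apply atoms_of_logarithmic.
  - repeat apply List.Forall_cons; trivial;
      solve [now apply log_coord_inv | now apply log_w_inv].
  - intros i k u Hu; pose proof (RtoC_neq_0 _ (H1 u Hu)); pose proof (RtoC_neq_0 _ (H2 u Hu)).
    pose proof (RtoC_neq_0 _ (Hw u Hu)).
    destruct i as [|[|[|[|[|i]]]]]; destruct k as [|[|[|[|k]]]];
      unfold atom, log_atom; cbn; unfold rlinw, rlin, rcoord, rw; cbn;
      rewrite ?Cinv_RtoC, ?RtoC_opp; unfold Rdiv; rewrite ?RtoC_mult, <- ?Cinv_RtoC;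
      try (destruct i); unfold no_atom; cbn [fst snd]; field; auto.
  - intros i k u Hu Hk.
    destruct k as [|[|[|[|k]]]]; try lia.
    destruct i as [|[|[|[|[|i]]]]]; unfold log_atom; cbn [nth atoms_w snd];
      unfold rlinw, rlin;
      rewrite ?rcoord_far by lia; try (cbn [rw]; ring).
    destruct i; reflexivity.
Qed.

(* Its total derivative has the same coefficient of u_5 as the bracket. *)
Definition primitive_w tab : expr :=
  (- d tab 3 (d tab 3 (At 4))
   * (vd tab (At 3) * Var 4 - Rat (1#2) * d tab 2 (d tab 2 (At 3)) * Var 4 ^ 2))%E.

Definition remainder_w tab : expr :=
  (vd tab (At 3) * idv tab (At 4) - Dt tab (primitive_w tab))%E.

Ltac field_w at_ u :=
  rewrite ?RtoC_w; expand_evals;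
  change (at_ 0%nat u) with (/ RtoC (u 1%nat))%C;
  change (at_ 1%nat u) with (/ RtoC (u 2%nat))%C;
  change (at_ 2%nat u) with (/ RtoC (w u))%C;
  rewrite ?RtoC_w; field; auto.

(** Write subscripts for partial derivatives. In the bracket u_5 comes only from -D_x^2 g_3 and has
    coefficient -g_33 times the variational derivative of f. The latter is affine in u_4 with slope
    f_22, and [primitive_w] is the integral of this coefficient in u_4, whence its term with 1/2. *)
Lemma d5_remainder_w (al be ga : C) (f g : jet -> C) u :
  u 1%nat <> 0 -> u 2%nat <> 0 -> w u <> 0 ->
  let at_ := atom (atoms_w al be ga f g) in
  let tab := tab_w al be ga in
  eval at_ (d tab 5 (remainder_w tab)) u = 0%C.
Proof.
  intros H1 H2 Hw at_ tab.
  apply RtoC_neq_0 in H1, H2, Hw; rewrite RtoC_w in Hw.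
  unfold tab; field_w at_ u.
Qed.

(** The value is -3 f_22 g_333: the bracket contains -f_22 g_333 u_4^3, of which the subtracted
    total derivative removes half. *)
Lemma d444_remainder_w (al be ga : C) (f g : jet -> C) u :
  u 1%nat <> 0 -> u 2%nat <> 0 -> w u <> 0 ->
  let at_ := atom (atoms_w al be ga f g) in
  let tab := tab_w al be ga in
  eval at_ (d tab 4 (d tab 4 (d tab 4 (remainder_w tab)))) u
  = (al * (al - 1) * ga * (ga - 1) * (ga - 2)
     * (-3 * at_ 3%nat u * at_ 4%nat u * RtoC (u 1%nat) ^ 3
        / (RtoC (u 2%nat) ^ 2 * RtoC (w u) ^ 3)))%C.
Proof.
  intros H1 H2 Hw at_ tab.
  apply RtoC_neq_0 in H1, H2, Hw; rewrite RtoC_w in Hw.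
  unfold tab; field_w at_ u.
Qed.

(** At gamma = 2 the density is quadratic in u_3, so g_333 = 0 and the u_4^2-term leads. The value
    of [ga] is a hypothesis so that [ga] stays a variable while the expression is normalised. *)
Lemma d44_remainder_w (al be ga : C) (f g : jet -> C) u :
  u 1%nat <> 0 -> u 2%nat <> 0 -> w u <> 0 -> ga = RtoC 2 ->
  let at_ := atom (atoms_w al be ga f g) in
  let tab := tab_w al be ga in
  eval at_ (d tab 4 (d tab 4 (remainder_w tab))) u
  = (al * (al - 1) * (3 * be - 5 * al + 10)
     * (-2 * at_ 3%nat u * at_ 4%nat u * RtoC (u 1%nat)
        / (RtoC (u 2%nat) ^ 3 * RtoC (w u))))%C.
Proof.
  intros H1 H2 Hw Hga at_ tab.
  apply RtoC_neq_0 in H1, H2, Hw; rewrite RtoC_w in Hw.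
  unfold tab; expand_evals;
  change (at_ 0%nat u) with (/ RtoC (u 1%nat))%C;
  change (at_ 1%nat u) with (/ RtoC (u 2%nat))%C;
  change (at_ 2%nat u) with (/ RtoC (w u))%C.
  generalize (at_ 3%nat u) (at_ 4%nat u); intros.
  clear at_ tab; subst ga; rewrite ?RtoC_w; field; auto.
Qed.

Lemma commute_necessary (Om : jet -> Prop) (al be ga : C) (f g : jet -> C) :
  open Om -> (exists u, Om u) ->
  (forall u, Om u -> u 1%nat <> 0) -> (forall u, Om u -> u 2%nat <> 0) ->
  (forall u, Om u -> w u <> 0) ->
  (forall u, Om u -> f u <> 0%C) -> (forall u, Om u -> g u <> 0%C) ->
  logarithmic Om f (rlin (2 - 4 * al) al) ->
  logarithmic Om g (rlinw (2 - 4 * be - 7 * ga) be ga) ->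
  (al * (al - 1) * ga * (ga - 1))%C <> 0%C -> commute Om f g ->
  ga = 2%C /\ (3 * be = 5 * al - 10)%C.
Proof.
  intros HO [u Hu] H1 H2 Hw Nf Ng Hf Hg Hne Hz.
  assert (HA : atoms Om (atom (atoms_w al be ga f g)) (tab_w al be ga))
    by now apply atoms_w_ok.
  set (at_ := atom (atoms_w al be ga f g)) in *.
  set (tab := tab_w al be ga) in *.
  assert (Z : forall v, Om v -> eval at_ (d tab 4 (d tab 4 (remainder_w tab))) v = 0%C).
  { intros v Hv.
    apply (total_derivative_affine Om at_ tab (bracket f g) (primitive_w tab) _ 3 v);
      trivial.
    - intros x Hx; unfold remainder_w.
      rewrite eval_add, eval_mul, eval_opp.
      rewrite (bracket_eval Om at_ tab f g (At 3) (At 4)) by trivial; ring.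
    - intros x k Hx Hk.
      (* [ord] of the remainder computes to 5; the absence of u_5 is a cancellation that [ord] does
         not see. *)
      destruct (Nat.eq_dec k 5) as [-> | Hk5].
      + apply d5_remainder_w; auto.
      + assert (Hk' : (5 < k)%nat) by lia.
        apply (eval_d_ord Om); [exact HA | exact Hx | exact Hk']. }
  pose proof (RtoC_neq_0 _ (H1 u Hu)) as C1.
  pose proof (RtoC_neq_0 _ (H2 u Hu)) as C2.
  pose proof (RtoC_neq_0 _ (Hw u Hu)) as C3.
  pose proof (Nf u Hu) as C4; pose proof (Ng u Hu) as C5.
  assert (Ninv : forall x : C, x <> 0%C -> (/ x)%C <> 0%C).
  { intros x Hx E; assert (T : (x * / x = 1)%C) by (now apply Cinv_r).
    rewrite E, Cmult_0_r in T; injection T; lra. }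
  assert (Hal : (al * (al - 1))%C <> 0%C).
  { intros E; apply Hne; rewrite E; ring. }
  assert (Hga : ga = 2%C).
  { pose proof (eval_d_zero Om at_ tab _ 4 u HO HA Z Hu) as Z3.
    unfold tab, at_ in Z3; rewrite d444_remainder_w in Z3 by auto.
    apply Cmult_eq_0 in Z3; destruct Z3 as [Z3 | Z3].
    - apply Cmult_eq_0 in Z3; destruct Z3 as [Z3 | Z3]; [easy |].
      now apply Ceq_minus.
    - exfalso; revert Z3; unfold Cdiv;
      repeat first [apply Cmult_neq_0 | apply Ninv | apply Cpow_nz]; trivial;
        apply RtoC_neq_0; lra. }
  split; [exact Hga |].
  pose proof (Z u Hu) as Z2.
  unfold tab, at_ in Z2; rewrite d44_remainder_w in Z2 by auto.
  apply Cmult_eq_0 in Z2; destruct Z2 as [Z2 | Z2].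
  - apply Cmult_eq_0 in Z2; destruct Z2 as [Z2 | Z2]; [easy |].
    apply Ceq_minus; rewrite <- Z2; ring.
  - exfalso; revert Z2; unfold Cdiv.
    repeat first [apply Cmult_neq_0 | apply Ninv | apply Cpow_nz]; trivial;
        apply RtoC_neq_0; lra.
Qed.

(** * The rational cases alpha = -1 and alpha = 2 *)

(* [primitive_w2] needs both 1/u_1 and 1/u_2; at alpha = -1 the powers of 1/u_1,
   and at alpha = 2 those of 1/u_2, cancel against f and m. *)
Definition tab_inv (j : nat) (k i : nat) : expr :=
  match i with
  | O => if Nat.eqb k j then (- (At 0 * At 0))%E else Rat 0
  | _ => Rat 0
  end.

Definition atoms_inv (j : nat) :=
  ((fun u : jet => / RtoC (u j), fun u k => - RtoC (rcoord j u k)) :: nil)%C.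

Lemma atoms_inv_ok (Om : jet -> Prop) j :
  (j <= 3)%nat -> (forall u, Om u -> u j <> 0) ->
  atoms Om (atom (atoms_inv j)) (tab_inv j).
Proof.
  intros Hj H; apply atoms_of_logarithmic.
  - apply List.Forall_cons; [now apply log_coord_inv | apply List.Forall_nil].
  - intros [|[|i]] k u Hu; unfold atom, log_atom, atoms_inv, tab_inv, no_atom;
      cbn [nth fst snd]; [| rewrite Rat_0; ring | rewrite Rat_0; ring].
    unfold rcoord; destruct (Nat.eqb_spec k j) as [-> |].
    + rewrite Cinv_RtoC; cbn; rewrite ?Cinv_RtoC; ring.
    + rewrite Rat_0; ring.
  - intros [|[|i]] k u Hu Hk; try reflexivity.
    unfold log_atom; cbn; rewrite rcoord_far by lia; ring.
Qed.

(** This is [primitive_w2] at alpha = -1 with f = u_1^6/u_2 and m = u_1^8/u_2^5 inserted;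
    [primitive_2] arises likewise at alpha = 2 from f = u_2^2/u_1^6 and m = 1/u_1^12. *)
Definition primitive_minus_1 : expr :=
  (let y := At 0 in
   Rat (-2) * (Var 1 ^ 12 * y ^ 6 * (Rat 320 * W ^ 2 + Rat 72 * W ^ 3 * y ^ 2
     + Rat 9 * W ^ 4 * y ^ 4 + Rat 728 * Var 2 ^ 2 * W + Rat 896 * Var 2 ^ 4)
   + Var 1 ^ 14 * y ^ 6 * (Var 1 ^ 2 * y ^ 2 * Var 4 ^ 2
     - Var 4 * (Rat 60 * Var 2 + Rat 24 * W * y + Rat 6 * W ^ 2 * y ^ 3))))%E.

Definition primitive_2 : expr :=
  (let x := At 0 in
   x ^ 20 * (Rat 4 * W ^ 3 - Rat 278 * Var 2 ^ 2 * W ^ 2 - Rat 1288 * Var 2 ^ 4 * W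
              - Rat 1456 * Var 2 ^ 6)
   + x ^ 18 * Var 4 * (Rat 108 * Var 2 ^ 3 + Rat 48 * W * Var 2)
   - Rat 2 * x ^ 16 * Var 4 ^ 2)%E.

Ltac field_inv at_ j u :=
  expand_evals;
  change (at_ 0%nat u) with (/ RtoC (u j))%C;
  field; auto.

(** The domain may contain points with u_1 = 0, which the lemmas for gamma = 2 exclude; hence a
    primitive whose only denominator is u_2. *)
Lemma commute_alpha_minus_1 (Om : jet -> Prop) :
  open Om -> (forall u, Om u -> u 2%nat <> 0) ->
  commute Om
    (fun u => RtoC (u 1%nat ^ 6 / u 2%nat))
    (fun u => RtoC (u 1%nat ^ 8 * w u ^ 2 / u 2%nat ^ 5)).
Proof.
  intros HO H2; set (at_ := atom (atoms_inv 2)).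
  apply (commute_of_primitive Om at_ (tab_inv 2) _ _
    (Var 1 ^ 6 * At 0)%E (Var 1 ^ 8 * W ^ 2 * At 0 ^ 5)%E primitive_minus_1); trivial.
  - now apply atoms_inv_ok; [lia |].
  - intros u Hu; pose proof (RtoC_neq_0 _ (H2 u Hu)) as N.
    rewrite RtoC_div, RtoC_pow by auto; field_inv at_ 2%nat u.
  - intros u Hu; pose proof (RtoC_neq_0 _ (H2 u Hu)) as N.
    rewrite RtoC_div, RtoC_mult, !RtoC_pow, RtoC_w by (apply pow_nonzero; auto).
    field_inv at_ 2%nat u.
  - intros u Hu; pose proof (RtoC_neq_0 _ (H2 u Hu)) as N.
    field_inv at_ 2%nat u.
Qed.

Lemma commute_alpha_2 (Om : jet -> Prop) :
  open Om -> (forall u, Om u -> u 1%nat <> 0) ->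
  commute Om
    (fun u => RtoC (u 2%nat ^ 2 / u 1%nat ^ 6))
    (fun u => RtoC (w u ^ 2 / u 1%nat ^ 12)).
Proof.
  intros HO H1; set (at_ := atom (atoms_inv 1)).
  apply (commute_of_primitive Om at_ (tab_inv 1) _ _
    (Var 2 ^ 2 * At 0 ^ 6)%E (W ^ 2 * At 0 ^ 12)%E primitive_2); trivial.
  - now apply atoms_inv_ok; [lia |].
  - intros u Hu; pose proof (RtoC_neq_0 _ (H1 u Hu)) as N.
    rewrite RtoC_div, !RtoC_pow by (apply pow_nonzero; auto); field_inv at_ 1%nat u.
  - intros u Hu; pose proof (RtoC_neq_0 _ (H1 u Hu)) as N.
    rewrite RtoC_div, !RtoC_pow, RtoC_w by (apply pow_nonzero; auto).
    field_inv at_ 1%nat u.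
  - intros u Hu; pose proof (RtoC_neq_0 _ (H1 u Hu)) as N.
    field_inv at_ 1%nat u.
Qed.

(** * Densities with branches of powers *)

Lemma base1_branch_u2_neq_0 (Om : jet -> Prop) p a u :
  power_branch Om base1 a p -> Om u -> u 2%nat <> 0.
Proof.
  intros H Hu E; apply (proj2 (power_branch_neq_0 _ _ _ _ _ H Hu)).
  unfold base1; rewrite E; apply Rmult_0_l.
Qed.

Lemma base2_branch_w_neq_0 (Om : jet -> Prop) p a u :
  power_branch Om base2 a p -> Om u -> w u <> 0.
Proof.
  intros H Hu E; apply (proj2 (power_branch_neq_0 _ _ _ _ _ H Hu)).
  unfold base2; rewrite E; apply Rmult_0_l.
Qed.

Lemma RtoC_base1 u :
  u 1%nat <> 0 -> RtoC (base1 u) = (RtoC (u 2%nat) * (/ RtoC (u 1%nat)) ^ 4)%C.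
Proof.
  intros H; unfold base1; rewrite RtoC_div, RtoC_pow by now apply pow_nonzero.
  apply RtoC_neq_0 in H; field; auto.
Qed.

Lemma RtoC_base2 u :
  u 1%nat <> 0 -> RtoC (base2 u) = (RtoC (w u) * (/ RtoC (u 1%nat)) ^ 7)%C.
Proof.
  intros H; unfold base2; rewrite RtoC_div, RtoC_pow by now apply pow_nonzero.
  apply RtoC_neq_0 in H; field; auto.
Qed.

Lemma log_base1_power (Om : jet -> Prop) a p :
  open Om -> (forall u, Om u -> u 1%nat <> 0) -> power_branch Om base1 a p ->
  logarithmic Om p (rlin (-4 * a) a).
Proof.
  intros HO H1 Hp.
  assert (H2 : forall u, Om u -> u 2%nat <> 0)
    by (intros u Hu; now apply (base1_branch_u2_neq_0 Om p a)).
  apply (log_ext Om p p (fun u k => a * rlin (-4) 1 u k)%C); trivial.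
  - apply (log_power Om base1); trivial.
    apply (log_ext Om _ _ _ _ HO (log_mult Om _ _ _ _ (log_coord Om 2 H2)
      (log_pow Om _ _ 4 (log_coord_inv Om 1 H1)))).
    + intros u Hu; apply RtoC_base1; auto.
    + intros u k Hu; unfold rlin; simpl INR.
      replace (1 + 1 + 1 + 1) with 4 by ring; ring.
  - intros u k _; unfold rlin; ring.
Qed.

Lemma log_base2_power (Om : jet -> Prop) a p :
  open Om -> (forall u, Om u -> u 1%nat <> 0) -> power_branch Om base2 a p ->
  logarithmic Om p (rlinw (-7 * a) 0 a).
Proof.
  intros HO H1 Hp.
  assert (Hw : forall u, Om u -> w u <> 0)
    by (intros u Hu; now apply (base2_branch_w_neq_0 Om p a)).
  apply (log_ext Om p p (fun u k => a * rlinw (-7) 0 1 u k)%C); trivial.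
  - apply (log_power Om base2); trivial.
    apply (log_ext Om _ _ _ _ HO (log_mult Om _ _ _ _ (log_w Om Hw)
      (log_pow Om _ _ 7 (log_coord_inv Om 1 H1)))).
    + intros u Hu; apply RtoC_base2; auto.
    + intros u k Hu; unfold rlinw, rlin; simpl INR.
      replace (1 + 1 + 1 + 1 + 1 + 1 + 1) with 7 by ring; ring.
  - intros u k _; unfold rlinw, rlin; ring.
Qed.

Lemma log_u1_pow2 (Om : jet -> Prop) :
  (forall u, Om u -> u 1%nat <> 0) -> open Om ->
  logarithmic Om (fun u => RtoC (u 1%nat ^ 2)) (rlin 2 0).
Proof.
  intros H1 HO.
  apply (log_ext Om _ _ _ _ HO (log_pow Om _ _ 2 (log_coord Om 1 H1))).
  - intros u _; apply RtoC_pow.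
  - intros u k _; unfold rlin; simpl INR; replace (1 + 1) with 2 by ring; ring.
Qed.

Lemma commute_iff (al be ga : C) (Om : jet -> Prop) (f g : jet -> C) :
  (al * (al - 1) * ga * (ga - 1))%C <> RtoC 0 ->
  jet_domain Om -> (forall u, Om u -> u 1%nat <> 0) ->
  is_T1 Om al f -> is_T2 Om be ga g ->
  (commute Om f g <-> ga = RtoC 2 /\ (3 * be = 5 * al - 10)%C /\ defect al = 0%C).
Proof.
  intros Hne [[u0 Hu0] [HO _]] H1 [p [Hp Hf]] [p' [q [Hp' [Hq Hg]]]].
  assert (H2 : forall u, Om u -> u 2%nat <> 0)
    by (intros u Hu; now apply (base1_branch_u2_neq_0 Om p al)).
  assert (Hw : forall u, Om u -> w u <> 0)
    by (intros u Hu; now apply (base2_branch_w_neq_0 Om q ga)).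
  assert (N1 : forall u, Om u -> RtoC (u 1%nat ^ 2) <> 0%C)
    by (intros u Hu; apply RtoC_neq_0, pow_nonzero; auto).
  assert (Lf : logarithmic Om f (rlin (2 - 4 * al) al)).
  { apply (log_ext Om _ _ _ _ HO (log_mult Om _ _ _ _ (log_u1_pow2 Om H1 HO)
      (log_base1_power Om al p HO H1 Hp))); auto.
    intros u k _; unfold rlin; ring. }
  assert (Lp' := log_mult Om _ _ _ _ (log_u1_pow2 Om H1 HO)
      (log_base1_power Om be p' HO H1 Hp')).
  assert (Nf : forall u, Om u -> f u <> 0%C).
  { intros u Hu; rewrite Hf by exact Hu; apply Cmult_neq_0; auto.
    apply (power_branch_neq_0 _ _ _ _ _ Hp Hu). }
  assert (Np' : forall u, Om u -> (RtoC (u 1%nat ^ 2) * p' u)%C <> 0%C).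
  { intros u Hu; apply Cmult_neq_0; auto.
    apply (power_branch_neq_0 _ _ _ _ _ Hp' Hu). }
  (* At gamma = 2 the second power is w^2/u_1^14; [m] is the density with w^2 split off. *)
  set (m := fun u => (RtoC (u 1%nat ^ 2) * p' u * (/ RtoC (u 1%nat)) ^ 14)%C).
  assert (Lm : logarithmic Om m (rlin (-12 - 4 * be) be)).
  { apply (log_ext Om _ _ _ _ HO (log_mult Om _ _ _ _ Lp'
      (log_pow Om _ _ 14 (log_coord_inv Om 1 H1)))); auto.
    intros u k _; unfold rlin; rewrite INR_IZR_INZ; simpl Z.of_nat; ring. }
  assert (Nm : forall u, Om u -> m u <> 0%C).
  { intros u Hu; apply Cmult_neq_0; auto; apply Cpow_nz.
    rewrite Cinv_RtoC; apply RtoC_neq_0, Rinv_neq_0_compat; auto. }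
  assert (Hgm : ga = RtoC 2 -> forall u, Om u -> g u = (m u * RtoC (w u) ^ 2)%C).
  { intros E u Hu; rewrite E in Hq; rewrite Hg, (power_branch_2 _ _ _ u Hq Hu) by exact Hu.
    unfold m; rewrite RtoC_base2 by auto; ring. }
  split.
  - intros Hc.
    assert (E : ga = RtoC 2 /\ (3 * be = 5 * al - 10)%C).
    { apply (commute_necessary Om al be ga f g); trivial.
      - now exists u0.
      - intros u Hu; rewrite Hg by exact Hu; apply Cmult_neq_0; auto.
        apply (power_branch_neq_0 _ _ _ _ _ Hq Hu).
      - apply (log_ext Om _ _ _ _ HO (log_mult Om _ _ _ _ Lp'
          (log_base2_power Om ga q HO H1 Hq))); auto.
        intros u k _; unfold rlinw, rlin; ring. }
    destruct E as [Eg Eb]; split; [exact Eg |]; split; [exact Eb |].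
    apply (commute_w2_necessary Om al be f g m); auto.
    now exists u0.
  - intros [Eg [Eb Ed]]; apply (commute_w2_sufficient Om al be f g m); auto.
Qed.

Theorem proposition3 :
  (forall alpha beta gamma : C,
     (alpha * (alpha - 1) * gamma * (gamma - 1))%C <> RtoC 0 ->
   forall (Om : jet -> Prop) (f g : jet -> C),
     jet_domain Om ->
     (forall u, Om u -> u 1%nat <> 0) ->
     is_T1 Om alpha f ->
     is_T2 Om beta gamma g ->
     (commute Om f g <->
        (alpha = RtoC (1 / 2) /\ beta = RtoC (- 5 / 2) /\ gamma = RtoC 2) \/
        (alpha = RtoC (- 1) /\ beta = RtoC (- 5) /\ gamma = RtoC 2) \/
        (alpha = RtoC 2 /\ beta = RtoC 0 /\ gamma = RtoC 2)))
  /\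
  (forall (Om : jet -> Prop) (p q : jet -> C),
     jet_domain Om ->
     (forall u, Om u -> u 1%nat <> 0) ->
     power_branch Om (fun u => u 2%nat) (RtoC (1 / 2)) p ->
     power_branch Om (fun u => u 2%nat) (RtoC (5 / 2)) q ->
     commute Om p
       (fun u => (RtoC (w u ^ 2) / (RtoC (u 1%nat ^ 2) * q u))%C))
  /\
  (forall Om : jet -> Prop,
     jet_domain Om ->
     (forall u, Om u -> u 2%nat <> 0) ->
     commute Om
       (fun u => RtoC (u 1%nat ^ 6 / u 2%nat))
       (fun u => RtoC (u 1%nat ^ 8 * w u ^ 2 / u 2%nat ^ 5)))
  /\
  (forall Om : jet -> Prop,
     jet_domain Om ->
     (forall u, Om u -> u 1%nat <> 0) ->
     commute Om
       (fun u => RtoC (u 2%nat ^ 2 / u 1%nat ^ 6))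
       (fun u => RtoC (w u ^ 2 / u 1%nat ^ 12))).
Proof.
  split; [| split; [| split]].
  - intros al be ga Hne Om f g HO H1 Hf Hg.
    rewrite (commute_iff al be ga) by eassumption.
    split.
    + intros [Eg [Eb Ed]].
      assert (E : be = ((5 * al - 10) / 3)%C) by (rewrite <- Eb; field).
      assert (Hal : (al * (al - 1))%C <> 0%C).
      { intros Z; apply Hne; rewrite Z; ring. }
      unfold defect in Ed.
      (* The factor alpha (alpha - 1) is nonzero by hypothesis; each remaining root determines beta
         through 3 beta = 5 alpha - 10. *)
      apply Cmult_eq_0 in Ed; destruct Ed as [Ed | Ed];
        [apply Cmult_eq_0 in Ed; destruct Ed as [Ed | Ed];
         [apply Cmult_eq_0 in Ed; destruct Ed as [Ed | Ed]; [easy |] |] |].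
      * right; left.
        assert (Ea : al = RtoC (- 1)).
        { replace al with (al + 1 - 1)%C by ring; rewrite Ed; ring. }
        subst; repeat split; field.
      * right; right; apply Ceq_minus in Ed; subst; repeat split; field.
      * left.
        assert (Ea : al = RtoC (1 / 2)).
        { replace al with ((2 * al - 1 + 1) / 2)%C by field; rewrite Ed.
          rewrite RtoC_div by lra; field. }
        subst; repeat split; rewrite !RtoC_div by lra; field.
    + unfold defect; intros [[-> [-> ->]] | [[-> [-> ->]] | [-> [-> ->]]]];
        repeat split; rewrite ?RtoC_div by lra; field.
  - intros Om p q [_ [HO _]] H1 Hp Hq.
    assert (H2 : forall u, Om u -> u 2%nat <> 0)
      by (intros u Hu; apply (power_branch_neq_0 _ _ _ _ _ Hp Hu)).
    pose proof (log_coord Om 2 H2) as L2.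
    pose proof (power_branch_inv _ _ _ _ Hq) as Hq'.
    (* This lemma sees only logarithmic derivatives, so it applies to [p] without comparing it with
       a branch of u_1^2 (u_2/u_1^4)^(1/2). Here 2 - 4 alpha = 0 and -12 - 4 beta = -2, which gives
       m = u_1^(-2) u_2^(-5/2). *)
    apply (commute_w2_sufficient Om (RtoC (1 / 2)) (RtoC (- 5 / 2)) p _
      (fun u => (/ RtoC (u 1%nat)) ^ 2 * / q u)%C); trivial.
    + apply (log_ext Om _ _ _ _ HO (log_power Om _ _ _ _ HO L2 Hp)); trivial.
      intros u k _; unfold rlin; rewrite RtoC_div by lra; field.
    + apply (log_ext Om _ _ _ _ HO (log_mult Om _ _ _ _
        (log_pow Om _ _ 2 (log_coord_inv Om 1 H1))
        (log_power Om _ _ _ _ HO L2 Hq'))); trivial.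
      intros u k _; unfold rlin; rewrite INR_IZR_INZ; simpl Z.of_nat.
      rewrite !RtoC_div by lra; field.
    + intros u Hu; rewrite !RtoC_pow.
      pose proof (RtoC_neq_0 _ (H1 u Hu)).
      pose proof (proj1 (power_branch_neq_0 _ _ _ _ _ Hq Hu)).
      field; auto.
    + rewrite !RtoC_div by lra; field.
    + unfold defect; rewrite RtoC_div by lra; field.
  - intros Om [_ [HO _]] H2; now apply commute_alpha_minus_1.
  - intros Om [_ [HO _]] H1; now apply commute_alpha_2.
Qed.
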